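(* There is no nonlinear null curve $g:\mathbb{P}^1\to\mathbb{Q}^3$ of degree $5$.
   Context: $\langle\,,\rangle$ is a nondegenerate symmetric complex bilinear form on a $5$-dimensional complex vector space $W$, and $\mathbb{Q}^3=\{[w]\in\mathbb{P}(W):\langle w,w\rangle=0\}\subset\mathbb{P}(W)\simeq\mathbb{P}^4$ is the corresponding smooth quadric (all choices are linearly equivalent). Curves are holomorphic maps. A holomorphic curve $g:S\to\mathbb{Q}^3$ from a connected Riemann surface $S$ is a null curve if its tangent lines lie in $\mathbb{Q}^3$; equivalently, for local holomorphic nonvanishing lifts $G$ with $g=[G]$, one has $\langle G,G\rangle=\langle G,dG\rangle=\langle dG,dG\rangle=0$. It is nonlinear if its image is not contained in a linear $\mathbb{P}^1\subset\mathbb{P}(W)$. For compact $S$, the degree of a nonconstant $g$ is its degree as a map to $\mathbb{P}^4$: the number of points, counted with multiplicity, of the preimage of a hyperplane not containing the image. *)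

(* Defs.v *)
From HB Require Import structures.
From mathcomp Require Import all_boot all_order all_algebra.
From mathcomp Require Export complex.
From mathcomp Require Import all_classical all_reals all_analysis.
Set Implicit Arguments.
Unset Strict Implicit.
Unset Printing Implicit Defensive.
Import Order.TTheory GRing.Theory Num.Theory.
Import numFieldNormedType.Exports.
Local Open Scope classical_set_scope.
Local Open Scope ring_scope.
Local Open Scope complex_scope.

(* R[i] is only a field; its regular module R[i]^o carries the topology and the
   normed-module structure, so that derivatives over it are complex ones. *)
Notation Cplx R := ((R[i]^o)%type) (only parsing).

(* P(V) as the set of lines of V. *)
Notation proj V := {U : {vspace V} | \dim U == 1%N}.

Notation P1 R := (proj 'rV[(R : realType)[i]]_2).

(* The standard atlas of P^1: the chart of index i sends z to the line spanned
   by the vector with i-th coordinate 1 and other coordinate z. *)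
Definition chart_vec (R : realType) (i : 'I_2) (z : R[i]) : 'rV[R[i]]_2 :=
  \row_j (if j == i then 1 else z).

Lemma chart_dim (R : realType) (i : 'I_2) (z : R[i]) :
  \dim <[chart_vec i z]> == 1%N.
Proof.
rewrite dim_vline; suff -> : chart_vec i z != 0 by [].
by apply/eqP => /rowP /(_ i) /eqP; rewrite !mxE eqxx oner_eq0.
Qed.

Definition chart (R : realType) (i : 'I_2) (z : Cplx R) : P1 R :=
  Sub <[chart_vec i z]>%VS (chart_dim i z).

(* W has no prescribed norm: being finite-dimensional, it is differentiated
   through its linear forms. *)
Definition has_deriv (R : realType) (W : vectType R[i]) (G : Cplx R -> W)
    (z : Cplx R) (v : W) : Prop :=
  forall l : 'Hom(W, R[i]^o), is_derive z 1 (fun t => l (G t) : Cplx R) (l v).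

Definition local_lift (R : realType) (W : vectType R[i])
    (f : Cplx R -> proj W) (z : Cplx R) (G : Cplx R -> W) : Prop :=
  \forall t \near z, [/\ G t != 0, val (f t) = <[G t]>%VS
                       & exists v, has_deriv G t v].

Definition holomorphic (R : realType) (W : vectType R[i])
    (g : P1 R -> proj W) : Prop :=
  forall (i : 'I_2) (z : Cplx R), exists G, local_lift (g \o @chart R i) z G.

Record curve (R : realType) (W : vectType R[i]) := Curve {
  curve_fun :> P1 R -> proj W;
  curve_holomorphic : holomorphic curve_fun }.

Definition quadric (R : realType) (W : vectType R[i]) (form : {symmetric W}) :
    set (proj W) :=
  [set p : proj W | forall w, w \in val p -> form w w = 0].

Definition null_curve (R : realType) (W : vectType R[i])
    (form : {symmetric W}) (g : curve W) : Prop :=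
  range g `<=` quadric form /\
  forall (i : 'I_2) (z : Cplx R) (G : Cplx R -> W) (dG : W),
    local_lift (g \o @chart R i) z G -> has_deriv G z dG ->
    [/\ form (G z) (G z) = 0, form (G z) dG = 0 & form dG dG = 0].

Definition nonlinear (R : realType) (W : vectType R[i]) (g : curve W) : Prop :=
  ~ exists L : {vspace W}, \dim L = 2%N /\ forall p, (val (g p) <= L)%VS.

(* h vanishes to order m at z. *)
Definition vanishing_order (R : realType) (h : Cplx R -> Cplx R) (z : Cplx R)
    (m : nat) : Prop :=
  exists k : Cplx R -> Cplx R,
    [/\ k z != 0, \forall t \near z, derivable k t 1
      & \forall t \near z, h t = (t - z) ^+ m * k t].

(* Multiplicity of p in the preimage of the hyperplane l = 0. *)
Definition multiplicity (R : realType) (W : vectType R[i]) (g : curve W)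
    (l : 'Hom(W, R[i]^o)) (p : P1 R) (m : nat) : Prop :=
  forall (i : 'I_2) (z : Cplx R) (G : Cplx R -> W),
    chart i z = p -> local_lift (g \o @chart R i) z G ->
    vanishing_order (fun t => l (G t)) z m.

(* D lists the points of the preimage of the hyperplane, each repeated according
   to its multiplicity; points outside the preimage have multiplicity 0. *)
Definition has_degree (R : realType) (W : vectType R[i]) (g : curve W)
    (d : nat) : Prop :=
  exists (l : 'Hom(W, R[i]^o)) (D : seq (P1 R)),
    [/\ exists p, ~~ (val (g p) <= lker l)%VS,
        forall p, multiplicity g l p (count_mem p D)
      & size D = d].

(* Main.v *)
Require Import Defs.
From HB Require Import structures.
From mathcomp Require Import all_boot all_order all_algebra.
From mathcomp Require Import all_classical all_reals all_analysis.
From mathcomp Require Import ring lra zify.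
Set Implicit Arguments.
Unset Strict Implicit.
Unset Printing Implicit Defensive.
Import Order.TTheory GRing.Theory Num.Theory.
Import numFieldNormedType.Exports.
Import complex.ComplexField.Normc.
Local Open Scope classical_set_scope.
Local Open Scope ring_scope.
Local Open Scope complex_scope.

(* Dividing by a linear form with 5 zeros on the curve normalizes the local lifts
   to an entire lift of growth 5, which Liouville's theorem turns into a vector
   polynomial G of degree 5. Nullity means that <G(x), G(y)> vanishes to order 4
   on the diagonal, so <G(x), G(y)> = (x - y)^4 C(x, y) with
   C(x, y) = al x y + be (x + y) + ga. Since W has dimension 5, the 6x6 matrix of
   this form in the monomials is singular, which forces the discriminant of
   C(x, x) to vanish. If C is a nonzero square, the 5 coefficients of G away from
   its root already span W and the remaining one, which is orthogonal to them,
   vanishes: G has a zero or its degree drops. If C = 0, the coefficients of G span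
   an isotropic subspace, of dimension at most 2, and the curve is linear.

   Liouville's theorem for functions that are only assumed complex differentiable
   rests on Goursat's bisection argument. Applied to h(a + exp w) on the
   rectangle [s0, s1] x [0, 2 pi], it shows that the mean of h over a circle
   centered at a does not depend on the radius. *)

(** * Symmetric bilinear forms and null polynomials *)

Section bilinear_forms.
Import VectorInternalTheory.
Context {F : fieldType} {W : vectType F} (form : {symmetric W}).

Lemma symmetric_formC u v : form u v = form v u.
Proof. by rewrite hermC /= expr0 mul1r. Qed.

Lemma form_sumlr (I J : finType) (a : I -> F) (b : J -> F) (u : I -> W) (v : J -> W) :
  form (\sum_i a i *: u i) (\sum_j b j *: v j) =
  \sum_i \sum_j a i * b j * form (u i) (v j).
Proof.
rewrite linear_sumlz; apply: eq_bigr => i _.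
rewrite linear_sumr; apply: eq_bigr => j _.
by rewrite linearZlr /= mulrA.
Qed.

Lemma nondegenerate_eq0 : nondegenerate form ->
  forall u, (forall v, form u v = 0) -> u = 0.
Proof.
move=> /eqP nd u uP; apply/eqP; rewrite -memv0 -nd.
by apply/mem_orthovP => v _; exact: uP.
Qed.

(** Pairing a vanishing combination with [v]_r[, for r = 0, 1, ..., isolates the coefficient of
    index n - 1 - r: smaller indices pair to zero with]v[_r], and the coefficients of larger index
    already vanish. *)
Lemma free_antitriangular n (v : n.-tuple W) :
  (forall i j : 'I_n, (i + j < n.-1)%N -> form v`_i v`_j = 0) ->
  (forall i j : 'I_n, (i + j)%N = n.-1 -> form v`_i v`_j != 0) ->
  free v.
Proof.
move=> v0 vn0; apply/freeP => k kv i.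
suff H r (j : 'I_n) : (n <= j + r)%N -> k j = 0 by apply: (H n); rewrite leq_addl.
elim: r j {i} => [|r IH] j nj; first by rewrite addn0 leqNgt ltn_ord in nj.
case: (leqP n (j + r)) => [/IH//|jr].
have rn : (r < n)%N by exact: leq_ltn_trans (leq_addl _ _) jr.
have := congr1 (form v`_(Ordinal rn)) kv; rewrite linear0r linear_sumr.
rewrite (bigD1 j) //= linearZr /= big1 => [|i ij]; last first.
  rewrite linearZr /=; case: (ltngtP i j) => [lij|lij|eij].
  - by rewrite (v0 (Ordinal rn) i) ?mulr0 //=; move: nj jr lij; clear; lia.
  - by rewrite IH ?mul0r //; move: nj lij; clear; lia.
  - by move: ij; rewrite (val_inj eij) eqxx.
rewrite addr0 => /eqP; rewrite mulf_eq0 => /orP[/eqP//|].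
by rewrite (negPf (vn0 (Ordinal rn) j _)) //=; move: nj jr; clear; lia.
Qed.

(** With [M] the Gram matrix of W and [A] the coordinates of a basis of V, isotropy reads A M A^T =
    0. As [M] is invertible, both factors A and M A^T have rank dim V. *)
Lemma isotropic_dim (V : {vspace W}) : nondegenerate form ->
  {in V &, forall u v, form u v = 0} -> ((\dim V).*2 <= \dim {:W})%N.
Proof.
move=> nd iso; rewrite dimvf.
pose M : 'M[F]_(dim W) := \matrix_(i, j) form (r2v (delta_mx 0 i)) (r2v (delta_mx 0 j)).
pose A : 'M[F]_(\dim V, dim W) := \matrix_i v2r (vbasis V)`_i.
have formM u v : form u v = (v2r u *m M *m (v2r v)^T) 0 0.
  have E w : w = \sum_i v2r w 0 i *: r2v (delta_mx 0 i).
    rewrite -[LHS]v2rK [X in r2v X]row_sum_delta linear_sum.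
    by apply: eq_bigr => i _; rewrite linearZ.
  rewrite [u in LHS]E [v in LHS]E form_sumlr mxE exchange_big.
  apply: eq_bigr => j _; rewrite !mxE mulr_suml; apply: eq_bigr => i _.
  by rewrite !mxE mulrAC.
have rM : row_free M.
  apply: inj_row_free => u uM; apply: (can_inj r2vK); rewrite linear0.
  apply: (nondegenerate_eq0 nd) => w.
  by rewrite formM r2vK uM mul0mx mxE.
have rA : row_free A.
  apply: inj_row_free => u uA; apply/rowP => i; rewrite mxE.
  have /freeP := basis_free (vbasisP V); apply => {i}.
  apply: (can_inj v2rK); rewrite linear0 -uA mulmx_sum_row linear_sum.
  by apply: eq_bigr => i _; rewrite linearZ rowK.
have A0 : A *m (M *m A^T) = 0.
  apply/matrixP => i j; rewrite mulmxA [RHS]mxE.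
  have := formM (vbasis V)`_i (vbasis V)`_j.
  rewrite iso; [|by rewrite vbasis_mem // mem_nth // size_tuple..].
  move=> ->; rewrite !mxE; apply: eq_bigr => k _.
  by rewrite !mxE; congr (_ * _); apply: eq_bigr => m _; rewrite !mxE.
have := mulmx0_rank_max A0.
by rewrite (eqmxMfull _ _) ?mxrank_tr -/(row_free _) // (eqP rA) addnn.
Qed.

(** Nonlinearity speaks of subspaces of dimension exactly 2, whereas isotropy only bounds the
    dimension of a span by 2. *)
Lemma subspace_extend (V : {vspace W}) k : (\dim V <= k <= \dim {:W})%N ->
  exists2 L : {vspace W}, \dim L = k & (V <= L)%VS.
Proof.
elim: k => [|k IH] /andP[Vk kW].
  by exists V => //; apply/eqP; rewrite -leqn0.
case: (ltngtP (\dim V) k.+1) Vk => // [Vk _|Vk _]; last by exists V.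
have [|L Lk VL] := IH; first by rewrite -ltnS Vk ltnW.
pose w := vpick L^C.
have w0 : w != 0 by rewrite vpick0 -dimv_eq0 dimv_compl Lk subn_eq0 -ltnNge.
exists (L + <[w]>)%VS; last exact: subv_trans VL (addvSl _ _).
rewrite dimv_disjoint_sum ?Lk ?dim_vline ?w0 ?addn1 //.
apply/eqP; rewrite -subv0 -(capv_compl L) capvS //.
by rewrite -memvE memv_pick.
Qed.

End bilinear_forms.

(** * Null polynomial curves of degree at most 5 *)

Section null_polynomials.
Context {F : numClosedFieldType}.

Lemma poly_fun_eq0 (p : {poly F}) : (forall z, p.[z] = 0) -> p = 0.
Proof.
move=> p0; apply/eqP; apply/negPn/negP => pn0.
have us : uniq [seq (i%:R : F) | i <- iota 0 (size p)].
  by rewrite map_inj_uniq ?iota_uniq // => i j /eqP; rewrite eqr_nat => /eqP.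
have rs : all (root p) [seq i%:R | i <- iota 0 (size p)].
  by apply/allP => z _; apply/eqP; exact: p0.
by have := max_poly_roots pn0 rs us; rewrite size_map size_iota ltnn.
Qed.

(** The sum over i is the coefficient of z^n, with j = n - i; the guard [(i <= n)%N] is there
    because subtraction is truncated. *)
Lemma coef_double_sum m (A : nat -> nat -> F) :
  (forall z, \sum_(i < m) \sum_(j < m) z ^+ i * z ^+ j * A i j = 0) ->
  forall n, \sum_(i < m) (if (i <= n)%N && (n - i < m)%N then A i (n - i)%N else 0) = 0.
Proof.
move=> H n; pose p : {poly F} := \sum_(i < m) \sum_(j < m) A i j *: 'X^(i + j).
have p0 : p = 0.
  apply: poly_fun_eq0 => z; rewrite /p horner_sum -[RHS](H z).
  apply: eq_bigr => i _; rewrite horner_sum; apply: eq_bigr => j _.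
  by rewrite hornerZ hornerXn exprD mulrC.
transitivity p`_n; last by rewrite p0 coef0.
rewrite /p coef_sum.
apply: eq_bigr => i _; rewrite coef_sum; under eq_bigr do rewrite coefZ coefXn.
case: ifP => [/andP[ni nim]|nim].
  rewrite (bigD1 (Ordinal nim)) //= subnKC // eqxx mulr1 big1 ?addr0 // => j nj.
  case: eqP => [E|_]; last by rewrite mulr0.
  by move: nj; rewrite -val_eqE /= E addKn eqxx.
rewrite big1 // => j _; case: eqP => [E|_]; last by rewrite mulr0.
by move: nim; rewrite E leq_addr addKn ltn_ord.
Qed.

Context {W : vectType F} (form : {symmetric W}).

Definition vpoly (c : nat -> W) (z : F) : W := \sum_(i < 6) z ^+ i *: c i.

Definition vpoly_deriv (c : nat -> W) (z : F) : W :=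
  \sum_(i < 5) (i.+1%:R * z ^+ i) *: c i.+1.

(* In terms of polynomials: <G(x), G(y)> = (x - y)^4 (al x y + be (x + y) + ga). *)
Lemma null_gram (c : nat -> W) :
  (forall z, form (vpoly c z) (vpoly c z) = 0) ->
  (forall z, form (vpoly_deriv c z) (vpoly_deriv c z) = 0) ->
  exists al be ga : F, forall i j, (i < 6)%N -> (j < 6)%N ->
    form (c i) (c j) =
      if (i + j == 4)%N then ga * nth 0 [:: 1; -4; 6; -4; 1] i
      else if (i + j == 5)%N then be * nth 0 [:: 1; -3; 2; 2; -3; 1] i
      else if (i + j == 6)%N then al * nth 0 [:: 0; 1; -4; 6; -4; 1] i
      else 0.
Proof.
move=> G0 dG0.
pose A i j := form (c i) (c j).
have AC i j : A i j = A j i by exact: symmetric_formC.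
have H := @coef_double_sum 6 A (fun z => etrans (esym (form_sumlr form _ _ _ _)) (G0 z)).
have H' n : \sum_(i < 5) (if (i <= n)%N && (n - i < 5)%N then
    i.+1%:R * (n - i).+1%:R * A i.+1 (n - i).+1 else 0) = 0.
  apply: (@coef_double_sum 5 (fun i j => i.+1%:R * j.+1%:R * A i.+1 j.+1)) => z.
  rewrite -[RHS](dG0 z) form_sumlr; apply: eq_bigr => i _; apply: eq_bigr => j _.
  by rewrite -/(A _ _); ring.
(* The entries with i + j = n satisfy at most two equations, from z^n in <G, G> and from z^(n - 2)
   in <G', G'>. [comb] extracts an entry from a combination of two equations, up to a nonzero factor
   [k]. *)
have comb (k x y a s b t : F) : s = 0 -> t = 0 -> k != 0 ->
    k * (x - y) = a * s + b * t -> x = y.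
  move=> -> -> k0; rewrite !mulr0 addr0 => /eqP.
  by rewrite mulf_eq0 (negPf k0) subr_eq0 => /eqP.
pose symE := (AC 1%N 0%N, AC 2%N 0%N, AC 3%N 0%N, AC 4%N 0%N, AC 5%N 0%N,
  AC 2%N 1%N, AC 3%N 1%N, AC 4%N 1%N, AC 5%N 1%N, AC 3%N 2%N, AC 4%N 2%N,
  AC 5%N 2%N, AC 4%N 3%N, AC 5%N 3%N, AC 5%N 4%N).
(* s_n and t_n are the coefficients of z^n in <G, G> and <G', G'>. *)
have s0 : A 0%N 0%N = 0.
  by rewrite -[RHS](H 0%N) !big_ord_recl big_ord0 /= /bump /= !(subSS, subn0) ?symE; ring.
have s1 : 2 * A 0%N 1%N = 0.
  by rewrite -[RHS](H 1%N) !big_ord_recl big_ord0 /= /bump /= !(subSS, subn0) ?symE; ring.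
have s2 : 2 * A 0%N 2%N + A 1%N 1%N = 0.
  by rewrite -[RHS](H 2%N) !big_ord_recl big_ord0 /= /bump /= !(subSS, subn0) ?symE; ring.
have s3 : 2 * A 0%N 3%N + 2 * A 1%N 2%N = 0.
  by rewrite -[RHS](H 3%N) !big_ord_recl big_ord0 /= /bump /= !(subSS, subn0) ?symE; ring.
have s4 : 2 * A 0%N 4%N + 2 * A 1%N 3%N + A 2%N 2%N = 0.
  by rewrite -[RHS](H 4%N) !big_ord_recl big_ord0 /= /bump /= !(subSS, subn0) ?symE; ring.
have s5 : 2 * A 0%N 5%N + 2 * A 1%N 4%N + 2 * A 2%N 3%N = 0.
  by rewrite -[RHS](H 5%N) !big_ord_recl big_ord0 /= /bump /= !(subSS, subn0) ?symE; ring.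
have s6 : 2 * A 1%N 5%N + 2 * A 2%N 4%N + A 3%N 3%N = 0.
  by rewrite -[RHS](H 6%N) !big_ord_recl big_ord0 /= /bump /= !(subSS, subn0) ?symE; ring.
have s7 : 2 * A 2%N 5%N + 2 * A 3%N 4%N = 0.
  by rewrite -[RHS](H 7%N) !big_ord_recl big_ord0 /= /bump /= !(subSS, subn0) ?symE; ring.
have s8 : 2 * A 3%N 5%N + A 4%N 4%N = 0.
  by rewrite -[RHS](H 8%N) !big_ord_recl big_ord0 /= /bump /= !(subSS, subn0) ?symE; ring.
have s9 : 2 * A 4%N 5%N = 0.
  by rewrite -[RHS](H 9%N) !big_ord_recl big_ord0 /= /bump /= !(subSS, subn0) ?symE; ring.
have s10 : A 5%N 5%N = 0.
  by rewrite -[RHS](H 10%N) !big_ord_recl big_ord0 /= /bump /= !(subSS, subn0) ?symE; ring.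
have t0 : A 1%N 1%N = 0.
  by rewrite -[RHS](H' 0%N) !big_ord_recl big_ord0 /= /bump /= !(subSS, subn0) ?symE; ring.
have t1 : 4 * A 1%N 2%N = 0.
  by rewrite -[RHS](H' 1%N) !big_ord_recl big_ord0 /= /bump /= !(subSS, subn0) ?symE; ring.
have t2 : 6 * A 1%N 3%N + 4 * A 2%N 2%N = 0.
  by rewrite -[RHS](H' 2%N) !big_ord_recl big_ord0 /= /bump /= !(subSS, subn0) ?symE; ring.
have t3 : 8 * A 1%N 4%N + 12 * A 2%N 3%N = 0.
  by rewrite -[RHS](H' 3%N) !big_ord_recl big_ord0 /= /bump /= !(subSS, subn0) ?symE; ring.
have t4 : 10 * A 1%N 5%N + 16 * A 2%N 4%N + 9 * A 3%N 3%N = 0.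
  by rewrite -[RHS](H' 4%N) !big_ord_recl big_ord0 /= /bump /= !(subSS, subn0) ?symE; ring.
have t5 : 20 * A 2%N 5%N + 24 * A 3%N 4%N = 0.
  by rewrite -[RHS](H' 5%N) !big_ord_recl big_ord0 /= /bump /= !(subSS, subn0) ?symE; ring.
have t6 : 30 * A 3%N 5%N + 16 * A 4%N 4%N = 0.
  by rewrite -[RHS](H' 6%N) !big_ord_recl big_ord0 /= /bump /= !(subSS, subn0) ?symE; ring.
have t7 : 40 * A 4%N 5%N = 0.
  by rewrite -[RHS](H' 7%N) !big_ord_recl big_ord0 /= /bump /= !(subSS, subn0) ?symE; ring.
have t8 : 25 * A 5%N 5%N = 0.
  by rewrite -[RHS](H' 8%N) !big_ord_recl big_ord0 /= /bump /= !(subSS, subn0) ?symE; ring.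
have e01 : A 0%N 1%N = 0.
  by apply: (comb 2 _ _ 1 _ 0 _ s1 t0); [rewrite ?pnatr_eq0 ?oner_eq0|ring].
have e02 : A 0%N 2%N = 0.
  by apply: (comb 2 _ _ 1 _ (-1) _ s2 t0); [rewrite ?pnatr_eq0 ?oner_eq0|ring].
have e12 : A 1%N 2%N = 0.
  by apply: (comb 4 _ _ 0 _ 1 _ s3 t1); [rewrite ?pnatr_eq0 ?oner_eq0|ring].
have e03 : A 0%N 3%N = 0.
  by apply: (comb 4 _ _ 2 _ (-1) _ s3 t1); [rewrite ?pnatr_eq0 ?oner_eq0|ring].
have e13 : A 1%N 3%N = -4 * A 0%N 4%N.
  by apply: (comb 2 _ _ 4 _ (-1) _ s4 t2); [rewrite ?pnatr_eq0 ?oner_eq0|ring].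
have e22 : A 2%N 2%N = 6 * A 0%N 4%N.
  by apply: (comb 1 _ _ (-3) _ 1 _ s4 t2); [rewrite ?pnatr_eq0 ?oner_eq0|ring].
have e14 : A 1%N 4%N = -3 * A 0%N 5%N.
  by apply: (comb 4 _ _ 6 _ (-1) _ s5 t3); [rewrite ?pnatr_eq0 ?oner_eq0|ring].
have e23 : A 2%N 3%N = 2 * A 0%N 5%N.
  by apply: (comb 4 _ _ (-4) _ 1 _ s5 t3); [rewrite ?pnatr_eq0 ?oner_eq0|ring].
have e24 : A 2%N 4%N = -4 * A 1%N 5%N.
  by apply: (comb 2 _ _ 9 _ (-1) _ s6 t4); [rewrite ?pnatr_eq0 ?oner_eq0|ring].
have e33 : A 3%N 3%N = 6 * A 1%N 5%N.
  by apply: (comb 1 _ _ (-8) _ 1 _ s6 t4); [rewrite ?pnatr_eq0 ?oner_eq0|ring].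
have e25 : A 2%N 5%N = 0.
  by apply: (comb 4 _ _ 12 _ (-1) _ s7 t5); [rewrite ?pnatr_eq0 ?oner_eq0|ring].
have e34 : A 3%N 4%N = 0.
  by apply: (comb 4 _ _ (-10) _ 1 _ s7 t5); [rewrite ?pnatr_eq0 ?oner_eq0|ring].
have e35 : A 3%N 5%N = 0.
  by apply: (comb 2 _ _ 16 _ (-1) _ s8 t6); [rewrite ?pnatr_eq0 ?oner_eq0|ring].
have e44 : A 4%N 4%N = 0.
  by apply: (comb 1 _ _ (-15) _ 1 _ s8 t6); [rewrite ?pnatr_eq0 ?oner_eq0|ring].
have e45 : A 4%N 5%N = 0.
  by apply: (comb 2 _ _ 1 _ 0 _ s9 t0); [rewrite ?pnatr_eq0 ?oner_eq0|ring].
(* One entry stays free on each of the antidiagonals i + j = 6, 5, 4. *)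
exists (A 1%N 5%N), (A 0%N 5%N), (A 0%N 4%N).
case=> [|[|[|[|[|[|?]]]]]] [|[|[|[|[|[|?]]]]]] // _ _ /=;
  rewrite -/(A _ _) ?symE ?(s0, e01, t0, e02, e12, e03, e13, e22, e14, e23, e24, e33,
    e25, e34, e35, e44, e45, s10); ring.
Qed.

Lemma binomial_shift m j (z p : F) : (j < m)%N ->
  \sum_(i < m) z ^+ i * ('C(j, i)%:R * p ^+ (j - i)) = (z + p) ^+ j.
Proof.
move=> jm; rewrite addrC exprDn.
rewrite (big_ord_widen m (fun i => p ^+ (j - i) * z ^+ i *+ 'C(j, i))) //.
rewrite [RHS]big_mkcond; apply: eq_bigr => i _.
case: ltnP => [_|ji]; first by rewrite -mulr_natl; ring.
by rewrite bin_small // mul0r mulr0.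
Qed.

(** The coefficients of G(z + p). For j < i the truncated exponent [j - i] is harmless, since the
    binomial coefficient is zero. *)
Definition vshift (p : F) (c : nat -> W) (i : nat) : W :=
  \sum_(j < 6) ('C(j, i)%:R * p ^+ (j - i)) *: c j.

Lemma vpoly_shift p c z : vpoly (vshift p c) z = vpoly c (z + p).
Proof.
rewrite /vpoly /vshift; under eq_bigr do rewrite scaler_sumr.
rewrite exchange_big; apply: eq_bigr => j _.
by rewrite -(@binomial_shift 6) // scaler_suml; apply: eq_bigr => i _; rewrite scalerA.
Qed.

Lemma vpoly_deriv_shift p c z : vpoly_deriv (vshift p c) z = vpoly_deriv c (z + p).
Proof.
rewrite /vpoly_deriv /vshift; under eq_bigr do rewrite scaler_sumr.
rewrite exchange_big big_ord_recl /= big1 ?add0r; last first.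
  by move=> i _; rewrite bin0n mul0r scale0r scaler0.
apply: eq_bigr => j _; rewrite -(@binomial_shift 5) // mulr_sumr scaler_suml.
apply: eq_bigr => i _; rewrite scalerA /bump leq0n add1n subSS; congr (_ *: _).
have /(congr1 (fun n => n%:R : F)) := mul_bin_diag j.+1 i; rewrite !natrM /= => E.
transitivity (i.+1%:R * 'C(j.+1, i.+1)%:R * (z ^+ i * p ^+ (j - i))); first by ring.
by rewrite -E; ring.
Qed.

Lemma vshift5 p c : vshift p c 5 = c 5.
Proof.
rewrite /vshift big_ord_recr /= big1 => [|i _]; last first.
  by rewrite bin_small ?ltn_ord // mul0r scale0r.
by rewrite add0r binn subnn mulr1 scale1r.
Qed.

(** The five vectors are free, hence a basis of W, and only 0 is orthogonal to a basis. *)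
Lemma antitriangular_perp (u : nat -> W) (w : W) :
  \dim {:W} = 5%N -> nondegenerate form ->
  (forall i j, (i < 5)%N -> (j < 5)%N -> (i + j < 4)%N -> form (u i) (u j) = 0) ->
  (forall i j, (i < 5)%N -> (j < 5)%N -> (i + j = 4)%N -> form (u i) (u j) != 0) ->
  (forall i, (i < 5)%N -> form w (u i) = 0) -> w = 0.
Proof.
move=> dimW nd u0 un0 wu; pose v := [tuple u i | i < 5].
have vE (i : 'I_5) : v`_i = u i by rewrite nth_mktuple.
have fv : free v.
  by apply: (free_antitriangular (form := form)) => i j ij; rewrite !vE;
     [exact: u0 | exact: un0].
have bv : basis_of fullv v.
  by rewrite basisEfree fv subvf size_tuple dimW.
apply: (nondegenerate_eq0 nd) => x.
rewrite (coord_basis bv (memvf x)) linear_sumr big1 // => i _.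
by rewrite linearZr /= vE wu // mulr0.
Qed.

(** The hypotheses on [vpoly c] and [c 5] say that the lift vanishes neither at a finite point nor
    at infinity. Every nonzero C contradicts one of them or the dimension of W. *)
Lemma null_isotropic c : \dim {:W} = 5%N -> nondegenerate form ->
  (forall z, form (vpoly c z) (vpoly c z) = 0) ->
  (forall z, form (vpoly_deriv c z) (vpoly_deriv c z) = 0) ->
  (forall z, vpoly c z != 0) -> c 5 != 0 ->
  forall i j, (i < 6)%N -> (j < 6)%N -> form (c i) (c j) = 0.
Proof.
move=> dimW nd G0 dG0 Gn0 c5.
have [al [be [ga T]]] := null_gram G0 dG0.
have [/andP[/eqP al0 /eqP be0]|ab0] := boolP ((al == 0) && (be == 0)).
  have [ga0|ga0] := eqVneq ga 0.
    by move=> i j i6 j6; rewrite T // al0 be0 ga0 !mul0r; do !case: ifP.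
  (* C is a nonzero constant, with its double root at infinity: [c 0], ..., [c 4] have an
     antidiagonal Gram matrix, and [c 5] is orthogonal to all of them. *)
  move: c5; rewrite (@antitriangular_perp c (c 5%N)) ?eqxx // => i; [move=> j | move=> j |].
  - move=> i5 j5 ij; rewrite T; [|lia..]; rewrite al0 be0 !mul0r.
    by case: eqP => [|_]; [lia | do !case: ifP].
  - move=> i5 j5 ij; rewrite T; [|lia..]; rewrite ij eqxx mulf_neq0 //.
    by move: i i5 {ij} => [|[|[|[|[|?]]]]] //= _; rewrite ?oppr_eq0 ?pnatr_eq0 ?oner_eq0.
  - move=> i5; rewrite T; [|lia..]; rewrite al0 be0 !mul0r.
    by case: eqP => [|_]; [lia | do !case: ifP].
(* A finite root p of C(x, x) = al x^2 + 2 be x + ga. *)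
have [p pP] : exists p, al * p ^+ 2 + be * p *+ 2 + ga = 0.
  have [al0|al0] := eqVneq al 0.
    have be0 : be != 0 by move: ab0; rewrite al0 eqxx.
    by exists (- ga / (be *+ 2)); rewrite al0; field.
  pose D := sqrtC (be ^+ 2 - al * ga); have DE : D ^+ 2 = be ^+ 2 - al * ga by rewrite sqrtCK.
  exists ((- be + D) / al).
  transitivity ((D ^+ 2 - (be ^+ 2 - al * ga)) / al); first by field.
  by rewrite DE subrr mul0r.
(* Translating p to 0 makes the constant coefficient ga' of C vanish. *)
exfalso.
have c'5 := vshift5 p c.
have c'0 : vshift p c 0 = vpoly c p.
  rewrite -[p in RHS]add0r -vpoly_shift /vpoly big_ord_recl big1 ?addr0 /= => [|i _].
    by rewrite expr0 scale1r.
  by rewrite exprS mul0r scale0r.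
have [al' [be' [ga' T']]] : exists al be ga : F, _ := null_gram
  (fun z => etrans (congr1 (fun u => form u u) (vpoly_shift p c z)) (G0 (z + p)))
  (fun z => etrans (congr1 (fun u => form u u) (vpoly_deriv_shift p c z)) (dG0 (z + p))).
have ga'0 : ga' = 0.
  have := T' 0%N 4%N isT isT; rewrite /= mulr1 => <-.
  rewrite -pP /vshift form_sumlr !big_ord_recl !big_ord0 /= /bump /= !T //=.
  rewrite (_ : 'C(4, 4) = 1%N) // (_ : 'C(5, 4) = 5%N) // !bin0 ?bin_small //.
  by rewrite !subn0 (_ : (5 - 4)%N = 1%N) // (_ : (4 - 4)%N = 0%N) //; ring.
set d := vshift p c in c'5 c'0 T'.
(* The translation fixes the leading coefficient, and pairing with it reads off al' (k = 1) and be'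
   (k = 0). *)
have form5 k : form (d k) (d 5%N) =
    'C(0, k)%:R * p ^+ (0 - k) * be + 'C(1, k)%:R * p ^+ (1 - k) * al.
  rewrite c'5 /d /vshift linear_sumlz !big_ord_recl big_ord0 /= /bump /=.
  by rewrite !linearZl_LR /= !T //= /GRing.scale /=; ring.
have al'E : al' = al.
  have := T' 1%N 5%N isT isT; rewrite form5 /= [RHS]mulr1 => <-.
  by rewrite bin0n binn subnn /=; ring.
have be'E : be' = be + p * al.
  by have := T' 0%N 5%N isT isT; rewrite form5 /= [RHS]mulr1 => <-; rewrite !bin0 !subn0; ring.
(* If be' is nonzero, then as ga' = 0 the 6 x 6 Gram matrix is antitriangular with nonzero
   antidiagonal i + j = 5: six free vectors in dimension 5. *)
have [be'0|be'0] := eqVneq be' 0; last first.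
  pose v := [tuple d i | i < 6].
  have vE (i : 'I_6) : v`_i = d i by rewrite nth_mktuple.
  have : free v.
    apply: (free_antitriangular (form := form)) => i j /= ij; rewrite !vE T' // ga'0 !mul0r.
      by case: eqP => // _; case: eqP => [|_]; [lia | case: eqP => //; lia].
    rewrite ij /= mulf_neq0 //; case: i {ij} => [[|[|[|[|[|[|?]]]]]]] //= _;
      by rewrite ?oppr_eq0 ?pnatr_eq0 ?oner_eq0.
  by rewrite /free size_tuple => /eqP E; have := dimvS (subvf <<v>>); rewrite E dimW.
have [al'0|al'0] := eqVneq al' 0.
  by move: ab0 be'E; rewrite be'0 -al'E al'0 eqxx mulr0 addr0 => /= /[swap] <-; rewrite eqxx.
(* Only the antidiagonal i + j = 6 is left, so [d 1], ..., [d 5] span W and are orthogonal to [d 0],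
   which is G(p). *)
move: (Gn0 p); rewrite -c'0 (@antitriangular_perp (fun i => d i.+1) (d 0%N)) ?eqxx // => i.
- move=> j i5 j5 ij; rewrite T'; [|lia..]; rewrite be'0 ga'0 !mul0r.
  by case: eqP => // _; case: eqP => // _; case: eqP => //; lia.
- move=> j i5 j5 ij; rewrite T'; [|lia..]; have -> : (i.+1 + j.+1)%N = 6 by lia.
  rewrite /= mulf_neq0 //; move: i i5 {ij} => [|[|[|[|[|?]]]]] //= _;
      by rewrite ?oppr_eq0 ?pnatr_eq0 ?oner_eq0.
- move=> i5; rewrite T'; [|lia..]; rewrite be'0 ga'0 !mul0r /= mulr0.
  by do !case: ifP.
Qed.

End null_polynomials.

(** * Goursat's theorem and Liouville's theorem *)

(** Goursat's argument for an additive function of rectangles. One of the four quarters carries at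
    least a quarter of |Phi|; iterating, |Phi| of the whole is at most 4^n times |Phi| of a
    rectangle whose sides are divided by 2^n. Near the common point of these rectangles Phi is small
    compared to the square of the size. *)
Lemma bisection_eq0 (R : realType) (Phi : R -> R -> R -> R -> R) (a b c d : R) :
  a <= b -> c <= d ->
  (forall x y z u v, Phi x z u v = Phi x y u v + Phi y z u v) ->
  (forall x y u v w, Phi x y u w = Phi x y u v + Phi x y v w) ->
  (forall x0 y0, a <= x0 <= b -> c <= y0 <= d -> forall e : R, 0 < e ->
     exists2 dl : R, 0 < dl & forall x y u v, a <= x -> y <= b -> c <= u -> v <= d ->
       x <= x0 <= y -> u <= y0 <= v -> y - x < dl -> v - u < dl ->
       `|Phi x y u v| <= e * ((y - x) + (v - u)) ^+ 2) ->
  Phi a b c d = 0.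
Proof.
move=> ab cd PhiDx PhiDy Phio.
pose half (I : R * R) (i : bool) :=
  let m := (I.1 + I.2) / 2 in if i then (I.1, m) else (m, I.2).
pose T := ((R * R) * (R * R))%type.
pose F (r : T) : R := `|Phi r.1.1 r.1.2 r.2.1 r.2.2|.
have /choice[next nextP] : forall r : T, exists s : T,
    (exists i j, s = (half r.1 i, half r.2 j)) /\ F r <= 4 * F s.
  move=> [[x y] [u v]]; apply: contrapT => H.
  have {}H i j : F (half (x, y) i, half (u, v) j) < F ((x, y), (u, v)) / 4.
    rewrite ltNge; apply/negP => Hij; apply: H.
    exists (half (x, y) i, half (u, v) j); split; first by exists i, j.
    by rewrite -ler_pdivrMl// mulrC.
  have := H true true; have := H true false.
  have := H false true; have := H false false; rewrite /F /half /=.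
  rewrite (PhiDx x ((x + y) / 2) y) (PhiDy x _ u ((u + v) / 2)).
  rewrite (PhiDy ((x + y) / 2) y u ((u + v) / 2)).
  move: (Phi x _ u _) (Phi x _ _ v) (Phi _ y u _) (Phi _ y _ v) => p q s t.
  have := ler_normD (p + q) (s + t).
  have := ler_normD s t; have := ler_normD p q.
  move: `|p + q + (s + t)| `|p| `|q| `|s| `|t| `|p + q| `|s + t| => *; lra.
pose r n : T := iter n next ((a, b), (c, d)).
have rS n : r n.+1 = next (r n) by [].
have FP n : F (r 0) <= 4 ^+ n * F (r n).
  elim: n => [|n IH]; first by rewrite expr0 mul1r.
  apply: le_trans IH _; rewrite exprSr -mulrA ler_pM2l ?exprn_gt0 //.
  by have [] := nextP (r n).
have halfw I i : (half I i).2 - (half I i).1 = (I.2 - I.1) / 2.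
  by rewrite /half; case: i => /=; field.
have wx n : (r n).1.2 - (r n).1.1 = (b - a) / 2 ^+ n.
  elim: n => [|n IH]; first by rewrite expr0 divr1.
  have [[i [j E]] _] := nextP (r n).
  by rewrite rS E halfw IH exprSr invfM mulrA.
have wy n : (r n).2.2 - (r n).2.1 = (d - c) / 2 ^+ n.
  elim: n => [|n IH]; first by rewrite expr0 divr1.
  have [[i [j E]] _] := nextP (r n).
  by rewrite rS E halfw IH exprSr invfM mulrA.
have halfm (I : R * R) i : I.1 <= I.2 ->
    [/\ I.1 <= (half I i).1, (half I i).1 <= (half I i).2 & (half I i).2 <= I.2].
  by rewrite /half; case: i => /= ?; split; lra.
have inv n : ((r n).1.1 <= (r n).1.2) /\ ((r n).2.1 <= (r n).2.2).
  by rewrite -subr_ge0 wx -[(_.2.1 <= _)]subr_ge0 wy !divr_ge0 ?subr_ge0 ?exprn_ge0.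
have mono1 n : [/\ (r n).1.1 <= (r n.+1).1.1, (r n.+1).1.2 <= (r n).1.2,
     (r n).2.1 <= (r n.+1).2.1 & (r n.+1).2.2 <= (r n).2.2].
  have [[i [j E]] _] := nextP (r n); have [i1 i2] := inv n.
  by rewrite rS E /=; have [] := halfm _ i i1; have [] := halfm _ j i2.
have mono n k : [/\ (r n).1.1 <= (r (n + k)%N).1.1, (r (n + k)%N).1.2 <= (r n).1.2,
     (r n).2.1 <= (r (n + k)%N).2.1 & (r (n + k)%N).2.2 <= (r n).2.2].
  elim: k => [|k [*]]; first by rewrite addn0.
  rewrite addnS; have [*] := mono1 (n + k)%N.
  by split; apply: le_trans; eauto.
have nested (lo hi : nat -> R) :
    (forall n, lo n <= hi n) ->
    (forall n k, lo n <= lo (n + k)%N /\ hi (n + k)%N <= hi n) ->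
    exists x, forall n, lo n <= x <= hi n.
  move=> lohi lm; have lh m n : lo m <= hi n.
    have [h _] := lm m n; have [_ h'] := lm n m.
    by apply: le_trans h _; apply: le_trans (lohi _) _; rewrite addnC.
  exists (sup (range lo)) => n; apply/andP; split.
    apply: ub_le_sup; last by exists n.
    by exists (hi 0) => _ [m _ <-].
  by apply: ge_sup; [exists (lo 0), 0 | move=> _ [m _ <-]].
have [x0 x0P] : exists x0, forall n, (r n).1.1 <= x0 <= (r n).1.2.
  by apply: (nested (fun n => (r n).1.1) (fun n => (r n).1.2)) => [n|n k];
     [have [] := inv n | have [] := mono n k].
have [y0 y0P] : exists y0, forall n, (r n).2.1 <= y0 <= (r n).2.2.
  by apply: (nested (fun n => (r n).2.1) (fun n => (r n).2.2)) => [n|n k];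
     [have [] := inv n | have [] := mono n k].
apply/eqP; rewrite -normr_le0; apply/ler_addgt0Pr => e e0; rewrite add0r.
set L := (b - a) + (d - c).
have L0 : 0 <= L by rewrite /L; lra.
(* This tolerance makes the final bound e L^2 / (L^2 + 1) <= e, including the degenerate case L =
   0. *)
have e'0 : 0 < e / (L ^+ 2 + 1).
  by rewrite divr_gt0 // ltr_wpDl ?sqr_ge0.
have [dl dl0 dlP] := Phio x0 y0 (x0P 0) (y0P 0) _ e'0.
have [n nP] : exists n, L / 2 ^+ n < dl.
  have := @cvg_geometric R L 2^-1.
  rewrite ger0_norm ?invr_ge0// invf_lt1// ltr1n => /(_ isT) /cvgrPdist_lt /(_ dl dl0).
  case=> n _ /(_ n (leqnn n)) /=; rewrite sub0r normrN /geometric /= exprVn.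
  by rewrite ger0_norm ?divr_ge0 ?exprn_ge0 //; exists n.
have p2 : 0 < 2 ^+ n :> R by rewrite exprn_gt0.
have := FP n; rewrite /F /= => /le_trans; apply.
have [m1 m2 m3 m4] := mono 0 n; rewrite add0n in m1 m2 m3 m4.
have {}dlP := dlP _ _ _ _ m1 m2 m3 m4 (x0P n) (y0P n).
have small w : w <= L -> w / 2 ^+ n < dl.
  by move=> wL; apply: le_lt_trans nP; rewrite ler_pM2r ?invr_gt0.
have {}dlP : `|Phi (r n).1.1 (r n).1.2 (r n).2.1 (r n).2.2| <=
    e / (L ^+ 2 + 1) * ((b - a) / 2 ^+ n + (d - c) / 2 ^+ n) ^+ 2.
  by rewrite -wx -wy; apply: dlP; rewrite ?wx ?wy; apply: small; rewrite /L; lra.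
have -> : (4 : R) ^+ n = 2 ^+ n ^+ 2 by rewrite exprAC; congr (_ ^+ _); ring.
apply: (@le_trans _ _ (2 ^+ n ^+ 2 *
    (e / (L ^+ 2 + 1) * ((b - a) / 2 ^+ n + (d - c) / 2 ^+ n) ^+ 2))).
  by rewrite ler_pM2l ?exprn_gt0.
rewrite -mulrDl -/L exprMn exprVn.
have -> : 2 ^+ n ^+ 2 * (e / (L ^+ 2 + 1) * (L ^+ 2 / 2 ^+ n ^+ 2)) =
    e * (L ^+ 2 / (L ^+ 2 + 1)).
  field; rewrite gt_eqF //=; nra.
by rewrite ler_piMr ?(ltW e0) // ler_pdivrMr; nra.
Qed.

(** * Primitives of continuous real functions *)

Section primitive.
Context {R : realType}.
Implicit Types (f : R -> R) (A : R).

(** Integrals over [a, b] are written as differences of values of a primitive based at some A < a,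
    which makes it derivable on both sides at a. *)
Definition primitive A f (x : R) : R :=
  parameterized_integral (@lebesgue_measure R) A x f.

Lemma is_derive_primitive A f x : continuous f -> A < x ->
  is_derive x 1 (primitive A f) (f x).
Proof.
move=> cf Ax.
have fi : (@lebesgue_measure R).-integrable `[A, x + 1] (EFin \o f).
  apply: continuous_compact_integrable; first exact: segment_compact.
  exact: continuous_subspaceT.
have xx : x < x + 1 by rewrite ltrDl.
have [dF F'] := continuous_FTC1_closed xx fi Ax (cf x).
apply: DeriveDef; first exact: dF.
by rewrite -derive1E; exact: F'.
Qed.

(** The estimate of the integral of f - g by e (b - a), obtained from the mean value theorem for the
    difference of two primitives. *)
Lemma primitive_close A f (G g : R -> R) a b (e : R) :
  continuous f -> A < a -> a <= b ->
  (forall x, a <= x -> is_derive x 1 G (g x)) ->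
  (forall x, a <= x <= b -> `|f x - g x| <= e) ->
  `|primitive A f b - primitive A f a - (G b - G a)| <= e * (b - a).
Proof.
move=> cf Aa ab dG fg.
pose h (x : R) := primitive A f x - G x.
have hd (x : R) : a <= x -> is_derive x 1 h (f x - g x).
  move=> ax; have h1 := is_derive_primitive cf (lt_le_trans Aa ax).
  have h2 := dG x ax; exact: is_deriveB.
have [x| |x xab E] := @MVT_segment R h (fun x => f x - g x) a b ab.
- by rewrite in_itv => /andP[/ltW ax _]; exact: hd.
- apply: continuous_in_subspaceT => x; rewrite inE /= in_itv /= => /andP[ax _].
  apply: differentiable_continuous; apply/derivable1_diffP.
  by have [] := hd x ax.
have -> : primitive A f b - primitive A f a - (G b - G a) = h b - h a.
  by rewrite /h; ring.
rewrite E normrM [X in _ * X]ger0_norm ?subr_ge0// ler_wpM2r ?subr_ge0 //.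
by apply: fg; rewrite in_itv in xab.
Qed.

Lemma primitive_affine A f a b c (al be e : R) : continuous f -> A < a -> a <= b ->
  (forall x, a <= x <= b -> `|f x - (al + be * (x - c))| <= e) ->
  `|primitive A f b - primitive A f a
     - (al * (b - a) + be * ((b - c) ^+ 2 - (a - c) ^+ 2) / 2)| <= e * (b - a).
Proof.
move=> cf Aa ab fe.
pose G (x : R) := al * x + be / 2 * (x - c) ^+ 2.
have dG x : a <= x -> is_derive x 1 G (al + be * (x - c)).
  by move=> _; apply: is_derive_eq; rewrite /GRing.scale/= !subr0 !mulr1; field.
have := primitive_close cf Aa ab dG fe; congr (`| _ - _ | <= _).
by rewrite /G; field.
Qed.

End primitive.

(** The integral of P dx + Q dy along the boundary of [a, b] x [c, d]. The form is closed in the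
    sense that the y-slope of P and the x-slope of Q are the same number [q] at each point.
    Bisection applies because the affine parts integrate to zero on small rectangles. *)
Lemma green_eq0 (R : realType) (P Q : R -> R -> R) (A B a b c d : R) :
  (forall y, continuous (P ^~ y)) -> (forall x, continuous (Q x)) ->
  A < a -> B < c -> a <= b -> c <= d ->
  (forall x0 y0, a <= x0 <= b -> c <= y0 <= d -> exists al be p q s : R,
    forall e : R, 0 < e -> exists2 dl : R, 0 < dl & forall x y,
      `|x - x0| < dl -> `|y - y0| < dl ->
      `|P x y - (al + p * (x - x0) + q * (y - y0))| <= e * (`|x - x0| + `|y - y0|) /\
      `|Q x y - (be + q * (x - x0) + s * (y - y0))| <= e * (`|x - x0| + `|y - y0|)) ->
  (primitive A (P ^~ c) b - primitive A (P ^~ c) a) -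
  (primitive A (P ^~ d) b - primitive A (P ^~ d) a) +
  (primitive B (Q b) d - primitive B (Q b) c) -
  (primitive B (Q a) d - primitive B (Q a) c) = 0.
Proof.
move=> cP cQ Aa Bc ab cd H.
pose Phi a b c d := (primitive A (P ^~ c) b - primitive A (P ^~ c) a) -
  (primitive A (P ^~ d) b - primitive A (P ^~ d) a) +
  (primitive B (Q b) d - primitive B (Q b) c) -
  (primitive B (Q a) d - primitive B (Q a) c).
apply: (@bisection_eq0 R Phi a b c d ab cd).
- by move=> x y z u v; rewrite /Phi; ring.
- by move=> x y u v w; rewrite /Phi; ring.
move=> x0 y0 x0P y0P e e0; have [al [be [p [q [s {}H]]]]] := H _ _ x0P y0P.
have [dl dl0 {}H] := H (e / 2) (divr_gt0 e0 (ltr0n _ 2)).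
exists dl => // x y u v ax yb cu vd /andP[x0l x0r] /andP[y0l y0r] wx wy.
set h := (y - x) + (v - u).
have {}H x' y' : x <= x' <= y -> u <= y' <= v ->
    `|P x' y' - (al + p * (x' - x0) + q * (y' - y0))| <= e / 2 * h /\
    `|Q x' y' - (be + q * (x' - x0) + s * (y' - y0))| <= e / 2 * h.
  move=> /andP[? ?] /andP[? ?].
  have hx : `|x' - x0| <= y - x by rewrite ler_norml; lra.
  have hy : `|y' - y0| <= v - u by rewrite ler_norml; lra.
  have [||h1 h2] := H x' y'; [exact: le_lt_trans hx wx|exact: le_lt_trans hy wy|].
  have E : e / 2 * (`|x' - x0| + `|y' - y0|) <= e / 2 * h.
    by rewrite ler_pM2l ?divr_gt0 // lerD.
  by split; [exact: le_trans h1 E | exact: le_trans h2 E].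
have xy : x <= y by lra.
have uv : u <= v by lra.
have PE w : u <= w <= v -> `|primitive A (P ^~ w) y - primitive A (P ^~ w) x
     - ((al + q * (w - y0)) * (y - x) + p * ((y - x0) ^+ 2 - (x - x0) ^+ 2) / 2)|
     <= e / 2 * h * (y - x).
  move=> wP; apply: primitive_affine => //; first by lra.
  by move=> x' /H /(_ wP) [+ _]; congr (`| _ | <= _); ring.
have QE w : x <= w <= y -> `|primitive B (Q w) v - primitive B (Q w) u
     - ((be + q * (w - x0)) * (v - u) + s * ((v - y0) ^+ 2 - (u - y0) ^+ 2) / 2)|
     <= e / 2 * h * (v - u).
  move=> wP; apply: primitive_affine => //; first by lra.
  by move=> y' /(H w _ wP) [_ +]; congr (`| _ | <= _); ring.
have uI : u <= u <= v by rewrite lexx.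
have vI : u <= v <= v by rewrite lexx andbT.
have xI : x <= x <= y by rewrite lexx.
have yI : x <= y <= y by rewrite lexx andbT.
move: (PE u uI) (PE v vI) (QE y yI) (QE x xI).
rewrite /Phi.
(* The deviations of the four side integrals from those of the affine parts; the latter cancel
   thanks to the common slope [q]. *)
set P1 := _ - _ - _; set P2 := _ - _ - _; set Q1 := _ - _ - _; set Q2 := _ - _ - _.
have -> : primitive A (P^~ u) y - primitive A (P^~ u) x -
   (primitive A (P^~ v) y - primitive A (P^~ v) x) +
   (primitive B (Q y) v - primitive B (Q y) u) -
   (primitive B (Q x) v - primitive B (Q x) u) = P1 - P2 + Q1 - Q2.
  by rewrite /P1 /P2 /Q1 /Q2; field.
have -> : e * h ^+ 2 = e / 2 * h * (y - x) + e / 2 * h * (y - x) +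
    (e / 2 * h * (v - u) + e / 2 * h * (v - u)) by rewrite /h; field.
move: P1 P2 Q1 Q2 (e / 2 * h * (y - x)) (e / 2 * h * (v - u)) => P1 P2 Q1 Q2 U V.
by rewrite !ler_norml => *; lra.
Qed.

(** * Limits and complex derivatives through the real modulus *)

Section complex_plane.
Context {R : realType}.
Local Notation C := (Cplx R).
Implicit Types (z w : C) (f : C -> C).

Lemma normcB z w : normc (z - w) = normc (w - z).
Proof. by rewrite -opprB normcN. Qed.

Lemma normc_ge0 z : 0 <= normc z.
Proof. by rewrite -ler0c; exact: (normr_ge0 (z : R[i])). Qed.

Lemma normc_gt0 z : (0 < normc z) = (z != 0).
Proof. by rewrite -ltcR; exact: (normr_gt0 (z : R[i])). Qed.

Lemma normc_Re z : `|complex.Re z| <= normc z.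
Proof. by rewrite -lecR; exact: normc_ge_Re. Qed.

Lemma normc_Im z : `|complex.Im z| <= normc z.
Proof.
by have := normc_Re (z * 'i); rewrite ReiNIm normrN normcM /= expr0n/= expr1n add0r
  sqrtr1 mulr1.
Qed.

Lemma normc_leD (x y : R) : normc (x +i* y) <= `|x| + `|y|.
Proof.
rewrite /= -[leRHS]ger0_norm ?addr_ge0// -sqrtr_sqr ler_sqrt ?sqr_ge0//.
rewrite sqrrD !real_normK ?num_real//.
have := mulr_ge0 (normr_ge0 x) (normr_ge0 y); lra.
Qed.

(** Balls of [R[i]^o] have radii in [R[i]], whose positive elements are the positive reals. Passing
    to real radii makes real estimates available. *)
Lemma near_normcP z (P : C -> Prop) :
  (\forall w \near z, P w) <->
  exists2 d : R, 0 < d & forall w, normc (w - z) < d -> P w.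
Proof.
split=> [/nbhs_ballP[e /= e0 eP]|[d d0 dP]].
  have := e0; rewrite ltcE /= => /andP[/eqP eI eR].
  exists (complex.Re e) => // w wz; apply: eP; rewrite -ball_normE /=.
  have -> : e = (complex.Re e)%:C by apply/eqP; rewrite eq_complex /= eI !eqxx.
  by rewrite distrC; move: wz; rewrite -ltcR.
apply/nbhs_ballP; exists d%:C => /=; first by rewrite ltcR.
by move=> w; rewrite -ball_normE /= distrC => wz; apply: dP; rewrite -ltcR.
Qed.

Lemma continuous_normcP f z : {for z, continuous f} <->
  forall e : R, 0 < e ->
    exists2 d : R, 0 < d & forall w, normc (w - z) < d -> normc (f w - f z) <= e.
Proof.
split=> [/cvgrPdist_le H e e0|H].
  apply/near_normcP; have e0' : 0 < e%:C by rewrite ltcR.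
  by apply: filterS (H _ e0') => w; rewrite distrC -lecR.
apply/(cvgrPdist_le (FF := nbhs_filter z)) => e; rewrite ltcE /= => /andP[/eqP eI eR].
have -> : e = (complex.Re e)%:C by apply/eqP; rewrite eq_complex /= eI !eqxx.
have /near_normcP := H _ eR.
by apply: filterS => w; rewrite distrC -lecR.
Qed.

(** Clearing the denominator of the difference quotient lets the estimate include w = z. *)
Lemma derivable_normcP f z : derivable f z 1 <->
  exists l, forall e : R, 0 < e -> exists2 d : R, 0 < d &
    forall w, normc (w - z) < d ->
      normc (f w - f z - l * (w - z)) <= e * normc (w - z).
Proof.
split=> [/cvg_ex[l /cvgrPdist_le H]|[l H]].
  exists l => e e0; have e0' : 0 < e%:C by rewrite ltcR.
  have := H _ e0'; rewrite near_withinE => /near_normcP[d d0 dP].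
  exists d => // w wz; have [->|wz0] := eqVneq w z.
    by rewrite !subrr mulr0 subr0 normc0 mulr0.
  have t0 : w - z != 0 by rewrite subr_eq0.
  have := dP (w - z); rewrite subr0 => /(_ wz t0) /=.
  rewrite /shift /= [_ *: 1]mulr1 subrK distrC => lP.
  have -> : f w - f z - l * (w - z) = ((w - z)^-1 *: (f w - f z) - l) * (w - z).
    by rewrite mulrBl /GRing.scale /= mulrAC mulVf // mul1r.
  by rewrite normcM ler_wpM2r ?normc_ge0 // -lecR.
apply/cvg_ex; exists l; apply/cvgrPdist_le => e; rewrite ltcE /= => /andP[/eqP eI eR].
have -> : e = (complex.Re e)%:C by apply/eqP; rewrite eq_complex /= eI !eqxx.
rewrite near_withinE; apply/near_normcP; have [d d0 dP] := H _ eR.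
exists d => // t; rewrite subr0 => td t0 /=.
have := dP (t + z); rewrite addrK => /(_ td).
rewrite /shift /= [_ *: 1]mulr1 distrC => lP.
have : normc (t^-1 *: (f (t + z) - f z) - l) <= complex.Re e.
  rewrite -(ler_pM2r (_ : 0 < normc t)) ?normc_gt0 // -normcM; apply: le_trans lP.
  by rewrite mulrBl /GRing.scale /= mulrAC mulVf // mul1r.
by rewrite -lecR.
Qed.

End complex_plane.

(** * The complex exponential *)

Section complex_exponential.
Context {R : realType}.
Local Notation C := (Cplx R).

Definition expC (w : C) : C :=
  (expR (complex.Re w) * cos (complex.Im w)) +i*
  (expR (complex.Re w) * sin (complex.Im w)).

Lemma expCD (w t : C) : expC (w + t) = expC w * expC t.
Proof.
case: w t => [x y] [u v]; rewrite /expC /= expRD cosD sinD.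
by apply/eqP; rewrite eq_complex /=; apply/andP; split; apply/eqP; ring.
Qed.

Lemma normc_expC (w : C) : normc (expC w) = expR (complex.Re w).
Proof.
by rewrite /= !exprMn -mulrDr cos2Dsin2 mulr1 sqrtr_sqr ger0_norm ?expR_ge0.
Qed.

Lemma is_derive_near0 (f : R -> R) (l : R) : is_derive (0 : R) 1 f l ->
  forall e : R, 0 < e -> exists2 d : R, 0 < d & forall t, `|t| < d ->
    `|f t - f 0 - l * t| <= e * `|t|.
Proof.
move=> [df fl] e e0; move: df => /cvg_ex[l' H].
have l'E : l' = l by rewrite -fl; apply/esym/cvg_lim.
move: H; rewrite {}l'E => /cvgrPdist_le /(_ _ e0).
rewrite near_withinE => /nbhs_ballP[d /= d0 dP]; exists d => // t td.
have [->|t0] := eqVneq t 0; first by rewrite subrr sub0r !mulr0 oppr0 normr0 mulr0.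
have := dP t; rewrite -ball_normE /= sub0r normrN => /(_ td t0).
rewrite /shift /= addr0 [_ *: 1]mulr1 => H.
rewrite distrC -(ler_pM2l (_ : 0 < `|t|^-1)) ?invr_gt0 ?normr_gt0 //.
rewrite mulrCA mulVf ?normr_eq0 // mulr1 -normfV -normrM.
by move: H; rewrite mulrBr mulrCA mulVf // mulr1.
Qed.

(** By [expCD] it suffices to expand at 0, where the expansions of [expR], [cos] and [sin] are
    combined. *)
Lemma derivable_expC (w : C) : derivable expC w 1.
Proof.
apply/derivable_normcP; exists (expC w) => e e0.
set K := expR (complex.Re w).
have K0 : 0 < K by exact: expR_gt0.
have e'0 : 0 < Num.min 1 (e / (8 * K)) by rewrite lt_min ltr01 divr_gt0 ?mulr_gt0.
set e' := Num.min _ _ in e'0.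
have e'1 : e' <= 1 by rewrite ge_min lexx.
have e'K : 8 * e' * K <= e.
  by rewrite mulrAC -ler_pdivlMl ?mulr_gt0 // [_^-1 * _]mulrC ge_min lexx orbT.
have [d1 d10 H1] := is_derive_near0 (is_derive_expR (0 : R)) e'0.
have [d2 d20 H2] := is_derive_near0 (is_derive_cos (0 : R)) e'0.
have [d3 d30 H3] := is_derive_near0 (is_derive_sin (0 : R)) e'0.
(* The radius e' / 2 gives |expR x - 1| <= 2 n < e' and expR x <= 2. The four error terms then total
   at most 6 e' n, within the allowed 8 e' n. *)
exists (Num.min (Num.min d1 d2) (Num.min d3 (e' / 2))).
  by rewrite !lt_min d10 d20 d30 divr_gt0.
move=> v vw; set t := v - w in vw *.
have tE : v = w + t by rewrite /t addrC subrK.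
rewrite tE expCD -[X in _ - X - _]mulr1 -mulrBr -mulrBr normcM normc_expC -/K.
clearbody t; clear tE v; case: t vw => x y /=.
rewrite -/(normc (x +i* y)) !lt_min => /andP[/andP[n1 n2] /andP[n3 n4]].
have xn := normc_Re (x +i* y : C); have yn := normc_Im (x +i* y : C).
rewrite /= -/(normc (x +i* y)) in xn yn.
set n : R := normc _ in n1 n2 n3 n4 xn yn *.
have {}H1 := H1 x (le_lt_trans xn n1).
have {}H2 := H2 y (le_lt_trans yn n2).
have {}H3 := H3 y (le_lt_trans yn n3).
rewrite expR0 cos0 sin0 oppr0 mul0r subr0 mul1r in H1 H2 H3.
rewrite addr0 mul1r in H3.
apply: le_trans (_ : K * (8 * e' * n) <= _); last first.
  by rewrite mulrA [K * _]mulrC ler_wpM2r ?normc_ge0.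
rewrite ler_pM2l //.
have n0 : 0 <= n by exact: normc_ge0.
rewrite subr0 -[leLHS]/(normc ((expR x * cos y - 1 - x) +i* (expR x * sin y - y))).
apply: le_trans (normc_leD _ _) _.
have ex : `|expR x - 1| <= 2 * n.
  have -> : expR x - 1 = (expR x - 1 - x) + x by ring.
  by apply: le_trans (ler_normD _ _) _; nra.
have ex1 : expR x <= 2 by move: ex; rewrite ler_norml; lra.
have ex0 := expR_ge0 x.
have -> : expR x * cos y - 1 - x = (expR x - 1 - x) + expR x * (cos y - 1) by ring.
have -> : expR x * sin y - y = expR x * (sin y - y) + (expR x - 1) * y by ring.
have := ler_normD (expR x - 1 - x) (expR x * (cos y - 1)).
have := ler_normD (expR x * (sin y - y)) ((expR x - 1) * y).
rewrite !normrM (ger0_norm ex0).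
have : `|expR x - 1| * `|y| <= e' * n.
  by apply: ler_pM => //; lra.
have : expR x * `|sin y - y| <= 2 * (e' * n).
  by apply: ler_pM => //; apply: le_trans H3 _; rewrite ler_pM2l.
have : expR x * `|cos y - 1| <= 2 * (e' * n).
  by apply: ler_pM => //; apply: le_trans H2 _; rewrite ler_pM2l.
have : `|expR x - 1 - x| <= e' * n by apply: le_trans H1 _; rewrite ler_pM2l.
have := mulr_ge0 (ltW e'0) n0.
have -> : 8 * e' * n = 8 * (e' * n) by ring.
move: (e' * n) => en *; lra.
Qed.

End complex_exponential.

(** * Integrals over circles in logarithmic coordinates *)

Section circle_mean.
Context {R : realType}.
Local Notation C := (Cplx R).
Implicit Types (H : C -> C).

Lemma ReB (u v : R[i]) : complex.Re (u - v) = complex.Re u - complex.Re v.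
Proof. by case: u v => ? ? []. Qed.

Lemma ImB (u v : R[i]) : complex.Im (u - v) = complex.Im u - complex.Im v.
Proof. by case: u v => ? ? []. Qed.

Lemma continuous_horizontal H (y : R) : continuous H ->
  continuous (fun x => complex.Im (H (x +i* y))).
Proof.
move=> cH x; apply/cvgrPdist_le => e e0.
have /continuous_normcP /(_ _ e0)[d d0 dP] := cH (x +i* y).
apply/nbhs_ballP; exists d => // t td; have {}td : `|t - x| < d by rewrite distrC.
rewrite distrC -ImB.
apply: le_trans (normc_Im _) _; apply: dP.
have -> : (t +i* y) - (x +i* y) = ((t - x) +i* (y - y)) :> R[i] by [].
apply: le_lt_trans (normc_leD _ _) _.
by rewrite subrr normr0 addr0.
Qed.

Lemma continuous_vertical H (x : R) : continuous H ->
  continuous (fun y => complex.Re (H (x +i* y))).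
Proof.
move=> cH y; apply/cvgrPdist_le => e e0.
have /continuous_normcP /(_ _ e0)[d d0 dP] := cH (x +i* y).
apply/nbhs_ballP; exists d => // t td; have {}td : `|t - y| < d by rewrite distrC.
rewrite distrC -ReB.
apply: le_trans (normc_Re _) _; apply: dP.
have -> : (x +i* t) - (x +i* y) = ((x - x) +i* (t - y)) :> R[i] by [].
apply: le_lt_trans (normc_leD _ _) _.
by rewrite subrr normr0 add0r.
Qed.

(* The base point -1 of the primitives is immaterial: any negative one would do. *)
Definition circle_integral H (x : R) : R :=
  primitive (-1) (fun y => complex.Re (H (x +i* y))) (pi *+ 2) -
  primitive (-1) (fun y => complex.Re (H (x +i* y))) 0.

Lemma circle_integral_close H (x c e : R) : continuous H ->
  (forall y, 0 <= y <= pi *+ 2 -> `|complex.Re (H (x +i* y)) - c| <= e) ->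
  `|circle_integral H x - c * (pi *+ 2)| <= e * (pi *+ 2).
Proof.
move=> cH Hc; have pi0 : 0 <= pi *+ 2 :> R by rewrite mulrn_wge0 ?pi_ge0.
have := @primitive_close R (-1) _ (fun y => c * y) (fun=> c) 0 (pi *+ 2) e
  (continuous_vertical cH).
rewrite mulr0 !subr0; apply => //.
by move=> y _; apply: is_derive_eq; rewrite /GRing.scale/= mulr1.
Qed.

(** Green's formula for Im (H dw) = Im H dx + Re H dy on [a, b] x [0, 2 pi]. By periodicity the
    horizontal sides cancel, and the vertical ones are the two circle integrals. *)
Lemma circle_integral_const H (a b : R) : continuous H ->
  (forall x, H (x +i* (pi *+ 2)) = H (x +i* 0)) -> a <= b ->
  (forall x y, a <= x <= b -> derivable H (x +i* y) 1) ->
  circle_integral H a = circle_integral H b.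
Proof.
move=> cH perH ab dH; have pi0 : 0 <= pi *+ 2 :> R by rewrite mulrn_wge0 ?pi_ge0.
have := @green_eq0 R (fun x y => complex.Im (H (x +i* y)))
  (fun x y => complex.Re (H (x +i* y))) (a - 1) (-1) a b 0 (pi *+ 2)
  (fun y => continuous_horizontal cH) (fun x => continuous_vertical cH).
rewrite (_ : (fun x => complex.Im (H (x +i* (pi *+ 2)))) =
  (fun x => complex.Im (H (x +i* 0)))); last by apply/funext => x; rewrite perH.
rewrite subrr add0r => /(_ _ _ ab _ _) E.
apply/esym/eqP; rewrite -subr_eq0; apply/eqP; apply: E => //; first lra.
move=> x0 y0 x0P _; have /derivable_normcP[[p q] dP] := dH x0 y0 x0P.
(* Cauchy-Riemann: if H' = p + i q, then Im H has slopes (q, p) and Re H has slopes (p, -q). *)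
exists (complex.Im (H (x0 +i* y0))), (complex.Re (H (x0 +i* y0))), q, p, (- q).
move=> e e0; have [d d0 {}dP] := dP e e0.
exists (d / 2); first by rewrite divr_gt0.
move=> x y xd yd.
have wE : (x +i* y) - (x0 +i* y0) = (x - x0) +i* (y - y0) :> R[i] by [].
have {}dP := dP (x +i* y); rewrite wE in dP.
have nn := normc_leD (x - x0) (y - y0).
have {}dP : normc (H (x +i* y) - H (x0 +i* y0) -
    (p +i* q) * ((x - x0) +i* (y - y0))) <= e * (`|x - x0| + `|y - y0|).
  apply: le_trans (dP _) _; last by rewrite ler_pM2l.
  by apply: le_lt_trans nn _; lra.
move: dP; case: (H (x +i* y)) (H (x0 +i* y0)) => [u v] [u0 v0] dP.
split; apply: le_trans dP; [have := normc_Im | have := normc_Re].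
all: move=> /(_ _ ((u +i* v) - (u0 +i* v0) - (p +i* q) * ((x - x0) +i* (y - y0)) : C)).
all: by congr (`| _ | <= _) => /=; ring.
Qed.

(** Compactness of [0, 2 pi] makes the continuity of H uniform in y. This carries the mean across
    the circles through exceptional points. *)
Lemma circle_integral_continuous H (x e : R) : continuous H -> 0 < e ->
  exists2 d : R, 0 < d & forall x', `|x' - x| < d ->
    `|circle_integral H x' - circle_integral H x| <= e.
Proof.
move=> cH e0; have pi0 : 0 < pi *+ 2 :> R by rewrite pmulrn_lgt0 ?pi_gt0.
have e'0 : 0 < e / (pi *+ 2) by rewrite divr_gt0.
have : \forall x' \near x, `[0, pi *+ 2] `<=` [set y : R |
    `|complex.Re (H (x' +i* y)) - complex.Re (H (x +i* y))| <= e / (pi *+ 2)].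
  have /compact_near_coveringP cov := @segment_compact R 0 (pi *+ 2).
  apply: (cov _ (nbhs x) (fun x' y => `|complex.Re (H (x' +i* y)) -
    complex.Re (H (x +i* y))| <= e / (pi *+ 2))) => y0 _.
  have e20 : 0 < e / (pi *+ 2) / 2 by rewrite divr_gt0.
  have /continuous_normcP /(_ _ e20)[d d0 dP] := cH (x +i* y0).
  have d20 : 0 < d / 2 by rewrite divr_gt0.
  exists ([set y | `|y - y0| < d / 2], [set x' | `|x' - x| < d / 2]) => [|[y x'] /= [yd xd]].
    by split; apply/nbhs_ballP; exists (d / 2) => // t td; rewrite /= distrC; exact: td.
  have near (t : R) : `|t - x| < d / 2 ->
      `|complex.Re (H (t +i* y)) - complex.Re (H (x +i* y0))| <= e / (pi *+ 2) / 2.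
    move=> td; have := dP (t +i* y).
    rewrite -[(t +i* y) - _]/((t - x) +i* (y - y0)) => H1.
    apply: le_trans (H1 _).
      by rewrite -ReB normc_Re.
    by apply: le_lt_trans (normc_leD _ _) _; lra.
  have := near _ xd; have := near x; rewrite subrr normr0 => /(_ d20).
  by rewrite !ler_norml; lra.
move=> /nbhs_ballP[d /= d0 dP]; exists d => // x' xd.
have {}dP y : 0 <= y <= pi *+ 2 -> `|complex.Re (H (x' +i* y)) - complex.Re (H (x +i* y))|
    <= e / (pi *+ 2).
  by move=> yI; apply: (dP x'); [rewrite /ball/= distrC|rewrite /= in_itv].
have := @primitive_close R (-1) _ (primitive (-1) (fun y => complex.Re (H (x +i* y))))
  (fun y => complex.Re (H (x +i* y))) 0 (pi *+ 2) (e / (pi *+ 2)) (continuous_vertical cH).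
rewrite subr0 divfK ?gt_eqF //; apply => //; first lra.
by move=> y y0; apply: is_derive_primitive; [exact: continuous_vertical|lra].
Qed.

End circle_mean.

(** Induction on T. Around the removed point c, m is constant on each side up to distance d / 2 from
    c, and continuity at c bridges the gap. *)
Lemma const_off_finite (R : realType) (m : R -> R) (T : seq R) :
  (forall s e, 0 < e -> exists2 d : R, 0 < d &
     forall s', `|s' - s| < d -> `|m s' - m s| <= e) ->
  (forall s0 s1, s0 <= s1 -> (forall t, s0 <= t <= s1 -> t \notin T) ->
     m s0 = m s1) ->
  forall s0 s1, s0 <= s1 -> m s0 = m s1.
Proof.
move=> cm; elim: T => [H s0 s1 s01|c T IH H]; first exact: H.
apply: IH => s0 s1 s01 TP.
suff mc s : s0 <= s <= s1 -> s0 <= c <= s1 -> m s = m c.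
  have [cI|cI] := boolP (s0 <= c <= s1); first by rewrite !mc ?lexx ?s01.
  apply: H => // t tI; rewrite inE negb_or TP // andbT.
  by apply: contraNneq cI => <-.
move=> sI cI; apply/eqP; rewrite -subr_eq0 -normr_le0; apply/ler_addgt0Pr => e e0.
rewrite add0r distrC; have [d d0 dP] := cm c e e0.
have [->|sc] := eqVneq s c; first by rewrite subrr normr0 ltW.
case: (ltP `|s - c| d) => [|dsc]; first by rewrite distrC; exact: dP.
have Teq s' s'' : s0 <= s' -> s' <= s'' -> s'' <= s1 -> (s'' < c) || (c < s') ->
    m s' = m s''.
  move=> h1 h2 h3 h4; apply: H => // t tI; rewrite inE negb_or TP ?andbT; last lra.
  by apply/eqP => tc; move: h4 tI; rewrite tc; lra.
case: (ltgtP s c) sc => // sc _.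
  have dsc' : d <= c - s by move: dsc; rewrite ltr0_norm; lra.
  rewrite (Teq s (c - d / 2)); [|lra..].
  by rewrite distrC; apply: dP; rewrite ltr_norml; lra.
have dsc' : d <= s - c by move: dsc; rewrite gtr0_norm; lra.
rewrite -(Teq (c + d / 2) s); [|lra..].
by rewrite distrC; apply: dP; rewrite ltr_norml; lra.
Qed.

(** * Liouville's theorem *)

Section liouville.
Context {R : realType}.
Local Notation C := (Cplx R).
Implicit Types (h f : C -> C) (S : seq C).

Lemma derivable_compC (f g : C -> C) (z : C) :
  derivable g z 1 -> derivable f (g z) 1 -> derivable (f \o g) z 1.
Proof.
move=> /derivable1_diffP dg /derivable1_diffP df.
by have /derivable1_diffP := differentiable_comp dg df.
Qed.

Lemma derivable_continuousC (f : C -> C) (z : C) :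
  derivable f z 1 -> {for z, continuous f}.
Proof. by move=> /derivable1_diffP; exact: differentiable_continuous. Qed.

Lemma derivable_mulC (f g : C -> C) (z : C) :
  derivable f z 1 -> derivable g z 1 -> derivable (fun w => f w * g w : C) z 1.
Proof. exact: (@derivableM R[i] C f g z 1). Qed.

Lemma derivable_invC (f : C -> C) (z : C) : f z != 0 ->
  derivable f z 1 -> derivable (fun w => (f w)^-1 : C) z 1.
Proof. exact: (@derivableV R[i] C f z 1). Qed.

Lemma derivable_subC (f g : C -> C) (z : C) :
  derivable f z 1 -> derivable g z 1 -> derivable (fun w => f w - g w : C) z 1.
Proof. exact: (@derivableB R[i] C C f g z 1). Qed.

(** The integral of Re h over the circle of radius e^s around a does not depend on s. It is close to
    2 pi Re h(a) for very negative s and close to 0 for large s. *)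
Lemma Re_eq0_of_vanish_at_infty h S (a : C) : continuous h ->
  (forall z, z \notin S -> derivable h z 1) ->
  (forall e : R, 0 < e -> exists B : R, forall z, B <= normc z -> normc (h z) <= e) ->
  complex.Re (h a) = 0.
Proof.
move=> ch dh h0.
pose H (w : C) : C := h (expC w + a).
have dE w : derivable (fun w : C => expC w + a : C) w 1.
  by apply: derivableD; [exact: derivable_expC | exact: derivable_cst].
have dH w : expC w + a \notin S -> derivable H w 1.
  by move=> wS; apply: (derivable_compC (dE w)); exact: dh.
have cH : continuous H.
  move=> w; apply: continuous_comp; first exact: derivable_continuousC.
  exact: ch.
have pi0 : 0 < pi *+ 2 :> R by rewrite pmulrn_lgt0 ?pi_gt0.
have per x : H (x +i* (pi *+ 2)) = H (x +i* 0).
  by rewrite /H /expC /= cos2pi sin2pi cos0 sin0.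
(* The line Re w = s meets an exceptional point only if e^s is the distance from a to a point of S.
   If a itself is in S, the default value of [ln 0] just adds one abscissa. *)
have mconst := @const_off_finite R (circle_integral H)
  [seq ln (normc (z - a)) | z <- S] (fun s e => circle_integral_continuous s cH).
have {}mconst s0 s1 : s0 <= s1 -> circle_integral H s0 = circle_integral H s1.
  apply: mconst => {}s0 {}s1 s01 TP; apply: circle_integral_const => // x y xI.
  apply: dH; apply/negP => wS; have /negP := TP _ xI; apply.
  apply/mapP; exists (expC (x +i* y) + a) => //.
  by rewrite addrK normc_expC expRK.
apply/eqP; rewrite -normr_le0; apply/ler_addgt0Pr => e e0; rewrite add0r.
have e20 : 0 < e / 2 by rewrite divr_gt0.
have /continuous_normcP /(_ _ e20)[d d0 dP] := ch a.
have [B BP] := h0 _ e20.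
(* As e^s1 >= 1 + s1, the large circle stays outside the disk of radius B around 0; as s0 < ln d,
   the small one lies within d of a. *)
pose s1 := Num.max 0 (B + normc a); pose s0 := Num.min 0 (ln d - 1).
have s01 : s0 <= s1 by rewrite /s0 /s1 le_max ge_min lexx.
have E0 : `|circle_integral H s0 - complex.Re (h a) * (pi *+ 2)| <= e / 2 * (pi *+ 2).
  apply: circle_integral_close => // y _; rewrite -ReB.
  apply: le_trans (normc_Re _) _; apply: dP.
  rewrite addrK normc_expC /= -[X in _ < X]lnK ?posrE // ltr_expR /s0 gt_min.
  by apply/orP; right; lra.
have E1 : `|circle_integral H s1 - 0 * (pi *+ 2)| <= e / 2 * (pi *+ 2).
  apply: circle_integral_close => // y _; rewrite subr0.
  apply: le_trans (normc_Re _) _; apply: BP.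
  have := le_normcD (expC (s1 +i* y) + a) (- a).
  rewrite addrK normcN normc_expC /=; have := expR_ge1Dx s1.
  have : B + normc a <= s1 by rewrite /s1 le_max lexx orbT.
  lra.
rewrite -(ler_pM2r pi0) -[in leLHS](ger0_norm (ltW pi0)) -normrM.
move: E0 E1; rewrite (mconst _ _ s01) mul0r subr0 !ler_norml.
move: (_ * (pi *+ 2)) (circle_integral _ _) => u v.
have -> : e * (pi *+ 2) = e / 2 * (pi *+ 2) + e / 2 * (pi *+ 2) by rewrite -mulrDl -splitr.
lra.
Qed.

Lemma eq0_of_vanish_at_infty h S : continuous h ->
  (forall z, z \notin S -> derivable h z 1) ->
  (forall e : R, 0 < e -> exists B : R, forall z, B <= normc z -> normc (h z) <= e) ->
  forall a, h a = 0.
Proof.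
move=> ch dh h0 a; apply/eqP; rewrite eq_complex; apply/andP; split; apply/eqP.
  exact: (Re_eq0_of_vanish_at_infty (S := S)).
apply: oppr_inj; rewrite -ReiNIm /= oppr0.
apply: (@Re_eq0_of_vanish_at_infty (fun z => h z * 'i) S).
- by move=> z; apply: continuousM; [exact: ch | exact: cst_continuous].
- by move=> z zS; exact: (derivable_mulC (dh z zS) (derivable_cst ('i : C) _ _)).
- move=> e /h0[B BP]; exists B => z /BP; rewrite normcM.
  by rewrite /= [in X in _ * X]expr0n/= expr1n add0r sqrtr1 mulr1.
Qed.

(* The difference quotient at a point a outside S lowers the growth; it is
   continuous at a but not known to be derivable there, hence the set S. *)
Lemma liouville_polynomial n h S (M : R) (B : R) : continuous h ->
  (forall z, z \notin S -> derivable h z 1) ->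
  (forall z, B <= normc z -> normc (h z) * normc z <= M * normc z ^+ n) ->
  exists2 p : {poly R[i]}, (size p <= n)%N & forall z, h z = p.[z].
Proof.
elim: n h S M B => [|n IH] h S M B ch dh hM.
  (* For n = 0 the growth bound reads |h(z)| |z| <= M, so h tends to 0 at infinity. *)
  exists 0; first by rewrite size_poly0.
  move=> z; rewrite horner0; apply: (@eq0_of_vanish_at_infty h S) => // e e0.
  exists (Num.max B (Num.max 1 (M / e))) => {}z; rewrite !ge_max => /and3P[zB z1 zM].
  have := hM z zB; rewrite expr0 mulr1 => H.
  move: zM; rewrite ler_pdivrMr // => zM.
  rewrite -(ler_pM2r (_ : 0 < normc z)); last by lra.
  by apply: le_trans H _; rewrite mulrC.
have [a aS] : exists a : C, a \notin S.
  (* A real number exceeding the modulus of every point of S. *)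
  exists (1 + \sum_(z <- S) normc z)%:C; apply/negP => aS.
  have : normc (1 + \sum_(z <- S) normc z)%:C <= \sum_(z <- S) normc z.
    by rewrite [leRHS](big_rem _ aS) /= lerDl sumr_ge0 // => *; exact: normc_ge0.
  rewrite /= expr0n /= addr0 sqrtr_sqr ger0_norm; last first.
    by rewrite addr_ge0 // sumr_ge0 // => *; exact: normc_ge0.
  lra.
have /derivable_normcP[l lP] := dh a aS.
pose g (z : C) : C := if z == a then l else (h z - h a) / (z - a).
have hg z : h z = h a + (z - a) * g z.
  rewrite /g; case: eqVneq => [->|za]; first by rewrite subrr mul0r addr0.
  by rewrite mulrCA divff ?subr_eq0 // mulr1 addrC subrK.
have dg z : z \notin a :: S -> derivable g z 1.
  rewrite inE negb_or => /andP[za zS].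
  have : derivable (fun w : C => (h w - h a) * (w - a)^-1 : C) z 1.
    apply: derivable_mulC.
      by apply: derivable_subC; [exact: dh | exact: derivable_cst].
    apply: derivable_invC; first by rewrite subr_eq0.
    by apply: derivable_subC; [exact: derivable_id | exact: derivable_cst].
  apply: near_eq_derivable.
  apply/near_normcP; exists (normc (z - a)); first by rewrite normc_gt0 subr_eq0.
  move=> w wz; rewrite /g; case: eqVneq wz => // ->.
  by rewrite normcB ltxx.
have cg : continuous g.
  move=> z; have [->|za] := eqVneq z a.
    apply/continuous_normcP => e e0; have [d d0 dP] := lP e e0.
    exists d => // w wa; rewrite [g a]/g eqxx /g.
    case: eqVneq => [_|wa0]; first by rewrite subrr normc0 ltW.
    rewrite -(ler_pM2r (_ : 0 < normc (w - a))) ?normc_gt0 ?subr_eq0 //.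
    by rewrite -normcM mulrBl divfK ?subr_eq0 //; exact: dP.
  have ck : {for z, continuous (fun w : C => (h w - h a) * (w - a)^-1 : C)}.
    apply: continuousM.
      by apply: continuousB; [exact: ch | exact: cst_continuous].
    apply: continuousV; first by rewrite subr_eq0.
    by apply: continuousB; [exact: cvg_id| exact: cst_continuous].
  apply/continuous_normcP => e e0.
  have /continuous_normcP /(_ _ e0)[d d0 dP] := ck.
  exists (Num.min d (normc (z - a))).
    by rewrite lt_min d0 normc_gt0 subr_eq0.
  move=> w; rewrite lt_min => /andP[/dP wd wz]; rewrite /g (negPf za).
  by case: eqVneq wz => // ->; rewrite normcB ltxx.
have [q qn qP] : exists2 q : {poly R[i]}, (size q <= n)%N & forall z, g z = q.[z].
  (* For |z| >= 1 + 2 |a| one has |z - a| >= |z| / 2, whence the factor 2, and |z| >= 1 absorbs the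
     constant h(a). *)
  apply: (IH g (a :: S) (2 * (M + normc (h a))) (Num.max B (1 + 2 * normc a)) cg dg) => z.
  rewrite ge_max => /andP[zB za]; have hz := hM z zB; set N : R := normc z in hz za *.
  have a0 := normc_ge0 (a : C); have N1 : 1 <= N by lra.
  have Nn : 1 <= N ^+ n by exact: exprn_ege1.
  have HN : normc (h z) * N <= M * N ^+ n * N by rewrite -mulrA -exprSr.
  have gN : normc (g z) * (N / 2) <= normc (h z) + normc (h a).
    apply: (@le_trans _ _ (normc (g z * (z - a)))).
      rewrite normcM ler_wpM2l ?normc_ge0 //.
      have := le_normcD (z - a) a; rewrite subrK -/N; lra.
    rewrite mulrC (_ : _ * _ = h z - h a); last by rewrite hg; ring.
    by apply: le_trans (le_normcD _ _) _; rewrite normcN.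
  have {}HN : normc (h z) <= M * N ^+ n by rewrite -(@ler_pM2r _ N) //; lra.
  have : normc (h a) <= normc (h a) * N ^+ n by rewrite ler_peMr ?normc_ge0.
  move: HN gN; lra.
exists ((h a)%:P + ('X - a%:P) * q); last first.
  by move=> z; rewrite hg qP !hornerE.
apply: leq_trans (size_polyD _ _) _; rewrite geq_max.
rewrite (leq_trans (size_polyC_leq1 _)) //=.
by apply: leq_trans (size_polyMleq _ _) _; rewrite size_XsubC.
Qed.

End liouville.

(** * Polynomial lifts of rational curves *)

Section projective_line.
Context {R : realType}.
Local Notation C := (Cplx R).

Lemma vline_scale (K : fieldType) (V : vectType K) (k : K) (v : V) :
  k != 0 -> <[k *: v]>%VS = <[v]>%VS.
Proof.
move=> k0; apply/eqP; rewrite eqEsubv -!memvE memvZ ?memv_line //=.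
by rewrite -{1}(scalerK k0 v) memvZ // memv_line.
Qed.

Lemma dim1_vline (K : fieldType) (V : vectType K) (U : {vspace V}) :
  \dim U == 1%N -> exists2 v, v != 0 & U = <[v]>%VS.
Proof.
move=> dU; exists (vpick U); first by rewrite vpick0 -dimv_eq0 (eqP dU).
apply/esym/eqP; rewrite eqEdim -memvE memv_pick (eqP dU) dim_vline.
by rewrite vpick0 -dimv_eq0 (eqP dU).
Qed.

Lemma chart_inv (z : C) : z != 0 -> chart ord0 z = chart ord_max (z^-1 : C).
Proof.
move=> z0; apply: val_inj => /=.
have -> : chart_vec ord0 z = z *: chart_vec ord_max z^-1; last by rewrite vline_scale.
apply/rowP => j; rewrite !mxE; case: eqVneq => [->|j0] /=; first by rewrite mulfV.
have -> : j = ord_max by apply/val_inj; case: j j0 => [[|[|?]]].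
by rewrite eqxx mulr1.
Qed.

Lemma P1_cases (p : P1 R) : p = chart ord_max (0 : C) \/ exists z : C, p = chart ord0 z.
Proof.
have [v v0 pv] := dim1_vline (valP p).
have [a0|a0] := eqVneq (v 0 ord0) 0; [left|right].
  apply: val_inj; rewrite [LHS]pv /=.
  have b0 : v 0 ord_max != 0.
    apply: contraNneq v0 => b0; apply/eqP/rowP => -[[|[|?]] j2] //; rewrite !mxE.
      by rewrite -[RHS]a0; congr (v _ _); apply: val_inj.
    by rewrite -[RHS]b0; congr (v _ _); apply: val_inj.
  rewrite -(vline_scale (chart_vec ord_max 0) b0); congr <[ _ ]>%VS.
  apply/rowP => j; rewrite !mxE; case: eqVneq => [->|jm]; first by rewrite mulr1.
  have -> : j = ord0 by apply/val_inj; case: j jm => [[|[|?]]].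
  by rewrite a0 mulr0.
exists (v 0 ord_max / v 0 ord0); apply: val_inj; rewrite [LHS]pv /=.
rewrite -(vline_scale (chart_vec ord0 _) a0); congr <[ _ ]>%VS.
apply/rowP => j; rewrite !mxE; case: eqVneq => [->|jm]; first by rewrite mulr1.
have -> : j = ord_max by apply/val_inj; case: j jm => [[|[|?]]].
by rewrite mulrC divfK.
Qed.

Lemma chart0_inj : injective (@chart R ord0).
Proof.
move=> z w /(congr1 val) /= E.
have : chart_vec ord0 z \in <[chart_vec ord0 w]>%VS by rewrite -E memv_line.
move=> /vlineP[k /rowP kP].
have := kP ord0; have := kP ord_max; rewrite !mxE /= mulr1 => -> <-.
by rewrite mul1r.
Qed.

Lemma chart0_infty (z : C) : chart ord0 z != chart ord_max (0 : C).
Proof.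
apply/eqP => /(congr1 val) /= E.
have : chart_vec ord0 z \in <[chart_vec ord_max 0%R]>%VS by rewrite -E memv_line.
move=> /vlineP[k /rowP /(_ ord0)]; rewrite !mxE /= mulr0 => /eqP.
by rewrite oner_eq0.
Qed.

(** Separates a hyperplane section into its finite points and the multiplicity at infinity. *)
Lemma affine_part (D : seq (P1 R)) : exists2 s : seq C,
  forall z : C, count_mem z s = count_mem (chart ord0 z) D &
  (size s + count_mem (chart ord_max (0%R : C)) D)%N = size D.
Proof.
elim: D => [|p D [s sD sz]]; first by exists [::].
case: (P1_cases p) => [->|[a ->]].
  exists s => /= [z|]; first by rewrite sD eq_sym (negPf (chart0_infty z)).
  by rewrite eqxx addnCA sz.
exists (a :: s) => /= [z|]; first by rewrite sD (inj_eq chart0_inj).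
by rewrite (negPf (chart0_infty a)) add0n addSn sz.
Qed.

Definition root_prod (s : seq C) (t : C) : C := \prod_(a <- s) (t - a).

Lemma derivable_root_prod (s : seq C) (t : C) : derivable (root_prod s) t 1.
Proof.
elim: s => [|a s IH].
  rewrite (_ : root_prod [::] = cst 1); first exact: derivable_cst.
  by apply/funext => x; rewrite /root_prod big_nil.
have da : derivable (fun x : C => x - a : C) t 1.
  exact: (derivable_subC (@derivable_id R[i] C t 1) (@derivable_cst R[i] C C a t 1)).
have E : (fun x : C => (x - a) * root_prod s x : C) = root_prod (a :: s).
  by apply/funext => x; rewrite /root_prod big_cons.
by rewrite -E; exact: derivable_mulC da IH.
Qed.

Lemma root_prod_split (s : seq C) (z t : C) :
  root_prod s t = (t - z) ^+ count_mem z s * root_prod [seq a <- s | a != z] t.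
Proof.
elim: s => [|a s IH]; first by rewrite /root_prod big_nil mulr1.
rewrite /root_prod /= big_cons -/(root_prod s t) IH.
case: eqVneq => [->|_] /=; first by rewrite exprS mulrA.
by rewrite big_cons mulrCA.
Qed.

Lemma root_prod_neq0 (s : seq C) (z : C) : z \notin s -> root_prod s z != 0.
Proof.
elim: s => [_|a s IH]; first by rewrite /root_prod big_nil oner_neq0.
rewrite inE negb_or => /andP[za zs]; rewrite /root_prod big_cons mulf_neq0 //.
  by rewrite subr_eq0.
exact: IH.
Qed.

Lemma near_neq0 (f : C -> C) (z : C) :
  {for z, continuous f} -> f z != 0 -> \forall t \near z, f t != 0.
Proof.
move=> /continuous_normcP cf; rewrite -normc_gt0 => fz.
have [|d d0 dP] := cf (normc (f z) / 2); first by rewrite divr_gt0.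
apply/near_normcP; exists d => // t /dP ft.
apply: contraTneq ft => ->; rewrite sub0r normcN -ltNge; lra.
Qed.

End projective_line.

(** * Local lifts and their gluing *)

Section lifts.
Context {R : realType} {W : vectType R[i]}.
Local Notation C := (Cplx R).
Implicit Types (f : C -> {U : {vspace W} | \dim U == 1%N}) (G : C -> W).

Lemma has_deriv_scale (a : C -> C) G (t : C) (v : W) :
  derivable a t 1 -> has_deriv G t v ->
  has_deriv (fun s => a s *: G s) t (a t *: v + ('D_1 a t : R[i]) *: G t).
Proof.
move=> da dG l.
have E : (fun s => l (a s *: G s) : C) = a * (fun s => l (G s) : C).
  by apply/funext => s; rewrite linearZ.
rewrite E.
have := @is_deriveM R[i] C a (fun s => l (G s) : C) t 1 _ _ (derivableP da) (dG l).
move=> [dd dE]; apply: DeriveDef => //; rewrite dE.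
by rewrite linearD !linearZ; congr (_ + _); exact: mulrC.
Qed.

Lemma has_deriv_near G G' (t : C) (v : W) :
  (\forall s \near t, G s = G' s) -> has_deriv G t v -> has_deriv G' t v.
Proof.
move=> GG' dG l; have := dG l; apply: near_eq_is_derive.
by apply: filterS GG' => s ->.
Qed.

Lemma local_lift_scale f z G (a : C -> C) : local_lift f z G ->
  (\forall t \near z, a t != 0 /\ derivable a t 1) ->
  local_lift f z (fun t => a t *: G t).
Proof.
move=> Gf az; apply: filterS2 Gf az => t [Gt ft [v dG]] [at0 da]; split.
- by rewrite scaler_eq0 negb_or at0.
- by rewrite vline_scale.
- by eexists; exact: has_deriv_scale da dG.
Qed.

(** Near z, l(G) = (t - z)^m k and [root_prod s] = (t - z)^m N with the same m and with k, N
    nonzero, so N / k is the rescaling required. *)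
Lemma local_lift_normalize f (l : 'Hom(W, R[i]^o)) (z : C) (s : seq C) G :
  local_lift f z G -> vanishing_order (fun t => l (G t)) z (count_mem z s) ->
  exists2 G', local_lift f z G' & \forall t \near z, l (G' t) = root_prod s t.
Proof.
move=> Gf [k [kz dk lG]].
pose N := root_prod [seq a <- s | a != z].
have dN t : derivable N t 1 by exact: derivable_root_prod.
have Nz : \forall t \near z, N t != 0.
  apply: near_neq0; first exact: derivable_continuousC.
  by apply: root_prod_neq0; rewrite mem_filter eqxx.
have kz' : \forall t \near z, k t != 0.
  apply: near_neq0 => //; apply: derivable_continuousC.
  exact: nbhs_singleton dk.
exists (fun t => (N t * (k t)^-1) *: G t).
  apply: local_lift_scale => //; apply: filterS3 Nz kz' dk => t Nt kt dkt.
  split; first by rewrite mulf_neq0 ?invr_eq0.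
  exact: (derivable_mulC (dN t) (derivable_invC kt dkt)).
apply: filterS2 kz' lG => t kt lGt.
rewrite linearZ /= lGt (root_prod_split s z) -/N.
by rewrite /GRing.scale /= mulrCA -mulrA mulVf // mulr1.
Qed.

(** On a line outside the hyperplane l = 0 the value of l determines the vector: this makes
    normalized lifts unique. *)
Lemma line_eq (l : 'Hom(W, R[i]^o)) (u v : W) :
  <[u]>%VS = <[v]>%VS -> l u = l v -> l v != 0 -> u = v.
Proof.
move=> uv luv lv; have /vlineP[k uE] : u \in <[v]>%VS by rewrite -uv memv_line.
move: luv; rewrite uE linearZ /= => /eqP.
rewrite -subr_eq0 -[X in _ - X]scale1r -scalerBl scaler_eq0 (negPf lv) orbF.
by rewrite subr_eq0 => /eqP ->; rewrite scale1r.
Qed.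

(** Each local lift L z is used only at z itself. Near z, it agrees with the resulting G: by
    [line_eq] off z, where [root_prod s] has no zero, and by definition at z. So G inherits
    derivability. *)
Lemma global_lift f (l : 'Hom(W, R[i]^o)) (s : seq C) :
  (forall z, exists2 G, local_lift f z G & \forall t \near z, l (G t) = root_prod s t) ->
  exists G : C -> W, forall t, [/\ G t != 0, val (f t) = <[G t]>%VS,
    l (G t) = root_prod s t & exists v, has_deriv G t v].
Proof.
move=> H.
have /choice[L LP] : forall z, exists G, local_lift f z G /\
    \forall t \near z, l (G t) = root_prod s t.
  by move=> z; have [G ? ?] := H z; exists G.
pose G z := L z z.
have Gz z : [/\ G z != 0, val (f z) = <[G z]>%VS & l (G z) = root_prod s z].
  have [Lf Ll] := LP z; have [? ? _] := nbhs_singleton Lf.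
  by split => //; exact: nbhs_singleton Ll.
have GL z : \forall t \near z, L z t = G t.
  have [Lf Ll] := LP z.
  pose N := root_prod [seq a <- s | a != z].
  have Nz : \forall t \near z, N t != 0.
    apply: near_neq0; first exact/derivable_continuousC/derivable_root_prod.
    by apply: root_prod_neq0; rewrite mem_filter eqxx.
  apply: filterS3 Lf Ll Nz => t [_ ft _] lL Nt.
  have [->//|tz] := eqVneq t z.
  have [_ ft' lG] := Gz t.
  apply: (@line_eq l); [by rewrite -ft -ft' | by rewrite lL lG |].
  by rewrite lG (root_prod_split s z) mulf_neq0 ?expf_neq0 ?subr_eq0.
exists G => t; have [? ? ?] := Gz t; split => //.
have [Lf _] := LP t; have [_ _ [v dL]] := nbhs_singleton Lf.
by exists v; apply: has_deriv_near dL; exact: GL.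
Qed.

End lifts.

(** * Behavior at infinity and polynomial lifts *)

Section polynomial_lift.
Context {R : realType} {W : vectType R[i]}.
Local Notation C := (Cplx R).
Implicit Types (f : C -> {U : {vspace W} | \dim U == 1%N}) (G : C -> W).

Lemma is_derive_hornerC (p : {poly R[i]}) (z : C) :
  is_derive z 1 (fun t : C => p.[t] : C) (p^`().[z] : C).
Proof.
elim/poly_ind: p => [|p c IH].
  have E : (fun t : C => 0.[t] : C) = cst 0 by apply/funext => t; rewrite horner0.
  by rewrite E deriv0 horner0; exact: is_derive_cst.
have E : (fun t : C => (p * 'X + c%:P).[t] : C) =
    (fun t : C => p.[t] : C) * (id : C -> C) + cst (c : C).
  by apply/funext => t; rewrite !hornerE.
have dX := @is_deriveM R[i] C (fun t : C => p.[t] : C) id z 1 _ _ IH (is_derive_id z 1).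
have dC := @is_derive_cst R[i] C C (c : C) z 1.
have [d dE] := @is_deriveD R[i] C C _ _ z 1 _ _ dX dC.
rewrite E; apply: DeriveDef => //; rewrite dE derivD derivM derivX derivC !hornerE.
by rewrite addrC /GRing.scale /= mulrC [_ * 1]mulr1; ring.
Qed.

Lemma lfun_vpoly (l : 'Hom(W, R[i]^o)) (c : nat -> W) (z : C) :
  l (vpoly c z) = (\sum_(j < 6) l (c j) *: 'X^j : {poly R[i]}).[z].
Proof.
rewrite /vpoly linear_sum horner_sum; apply: eq_bigr => j _.
by rewrite linearZ hornerZ hornerXn mulrC.
Qed.

Lemma has_deriv_vpoly (c : nat -> W) (z : C) :
  has_deriv (vpoly c : C -> W) z (vpoly_deriv c z).
Proof.
move=> l; have := is_derive_hornerC (\sum_(j < 6) l (c j) *: 'X^j) z.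
have -> : (fun t : C => (\sum_(j < 6) l (c j) *: 'X^j).[t] : C) =
    (fun t => l (vpoly c t) : C) by apply/funext => t; rewrite lfun_vpoly.
suff -> : ((\sum_(j < 6) l (c j) *: 'X^j)^`()).[z] = l (vpoly_deriv c z) by [].
rewrite raddf_sum big_ord_recl /= derivZ derivXn /= mulr0n scaler0 add0r.
rewrite horner_sum /vpoly_deriv linear_sum; apply: eq_bigr => j _.
rewrite derivZ derivXn hornerZ hornerMn hornerXn linearZ /= /bump leq0n add1n /=.
by rewrite -mulr_natl mulrC.
Qed.

(** In the coordinate t = 1/z, both t^(size s + m) G(1/t) and the rescaled lift K of f1 take the
    value t^m N(t) under l, so they agree off t = 0 by [line_eq]; K continues to t = 0 without
    vanishing. *)
Lemma lift_at_infty f f1 (l : 'Hom(W, R[i]^o)) (s : seq C) m G H :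
  (forall z : C, z != 0 -> f z = f1 (z^-1 : C)) ->
  (forall z, val (f z) = <[G z]>%VS /\ l (G z) = root_prod s z) ->
  local_lift f1 0 H -> vanishing_order (fun t => l (H t)) 0 m ->
  exists K : C -> W, [/\ K 0 != 0, val (f1 0) = <[K 0%R]>%VS,
    forall l' : 'Hom(W, R[i]^o), {for 0, continuous (fun t => l' (K t) : C)} &
    \forall t \near (0 : C), t != 0 -> t ^+ (size s + m) *: G t^-1 = K t].
Proof.
move=> ff1 fG Hf [k [k0 dk lH]].
(* The reversed polynomial of [root_prod s], equal to 1 at t = 0. *)
pose N (t : C) : C := \prod_(a <- s) (1 - t * a).
have NE (t : C) : t != 0 -> t ^+ size s * root_prod s t^-1 = N t.
  move=> t0; rewrite /N /root_prod; elim: (s) => [|a s' IH].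
    by rewrite !big_nil mulr1.
  rewrite !big_cons -IH /= exprS; set P := \prod_(_ <- _) _.
  transitivity ((t * (t^-1 - a)) * (t ^+ size s' * P)); first by ring.
  by rewrite mulrBr divff.
have dN (t : C) : derivable N t 1.
  rewrite /N; elim: (s) => [|a s' IH].
    have -> : (fun t : C => \prod_(a <- [::]) (1 - t * a) : C) = cst 1.
      by apply/funext => x; rewrite big_nil.
    exact: derivable_cst.
  have d1 : derivable (fun t : C => 1 - t * a : C) t 1.
    apply: (derivable_subC (@derivable_cst R[i] C C 1 t 1)).
    exact: (derivable_mulC (@derivable_id R[i] C t 1) (@derivable_cst R[i] C C a t 1)).
  have E : (fun t : C => (1 - t * a) * (\prod_(b <- s') (1 - t * b)) : C) =
      (fun t : C => \prod_(b <- a :: s') (1 - t * b) : C).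
    by apply/funext => x; rewrite big_cons.
  by rewrite -E; exact: derivable_mulC d1 IH.
have N0 : \forall t \near (0 : C), N t != 0.
  apply: near_neq0; first exact: derivable_continuousC.
  by rewrite /N big1 ?oner_neq0 // => a _; rewrite mul0r subr0.
have k0' : \forall t \near (0 : C), k t != 0.
  apply: near_neq0 => //; apply: derivable_continuousC.
  exact: nbhs_singleton dk.
pose K (t : C) := (N t * (k t)^-1) *: H t.
have Kf : local_lift f1 0 K.
  apply: local_lift_scale => //; apply: filterS3 N0 k0' dk => t Nt kt dkt.
  split; first by rewrite mulf_neq0 ?invr_eq0.
  exact: (derivable_mulC (dN t) (derivable_invC kt dkt)).
have [K0 fK0 [v dK]] := nbhs_singleton Kf.
exists K; split => // [l'|].
  by apply: derivable_continuousC; have [] := dK l'.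
have kN0 : \forall t \near (0 : C), k t != 0 /\ N t != 0 by exact: filterI k0' N0.
apply: filterS3 kN0 lH Kf => t [kt Nt] lHt [Kt fKt _] t0.
have lK : l (K t) = N t * t ^+ m.
  rewrite /K linearZ /= lHt subr0 /GRing.scale /= mulrCA -mulrA mulVf // mulr1.
  by rewrite mulrC.
apply: (@line_eq _ _ l).
- rewrite vline_scale ?expf_neq0 // -fKt -(fG _).1 ff1 ?invr_eq0 //.
  by rewrite invrK.
- rewrite linearZ lK /= (fG _).2 -NE // /GRing.scale /= exprD; ring.
- by rewrite lK mulf_neq0 ?expf_neq0.
Qed.

(** Boundedness of t^5 G(1/t) near 0 means growth of order at most 5, so Liouville's theorem applies
    to each coordinate of G. The value at t = 0 is then the coefficient of z^5. *)
Lemma polynomial_lift G (K : C -> W) :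
  (forall z, exists v, has_deriv G z v) ->
  (forall l' : 'Hom(W, R[i]^o), {for 0, continuous (fun t => l' (K t) : C)}) ->
  (\forall t \near (0 : C), t != 0 -> t ^+ 5 *: G t^-1 = K t) ->
  exists2 c, forall z, G z = vpoly c z & K 0 = c 5.
Proof.
move=> dG cK GK.
have poly_lG (l : 'Hom(W, R[i]^o)) : exists2 p : {poly R[i]}, (size p <= 6)%N &
    forall z, l (G z) = p.[z].
  have /continuous_normcP /(_ _ ltr01)[d1 d10 d1P] := cK l.
  have /near_normcP[d2 d20 d2P] := GK.
  (* Beyond this radius, 1/z lies within [d1] of 0, where l(K) is within 1 of its value at 0, and
     within [d2], where K is given by G. *)
  apply: (@liouville_polynomial _ 6 (fun z => l (G z) : C) [::]
    (normc (l (K 0)) + 1) (1 + d1^-1 + d2^-1)).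
  - by move=> z; apply: derivable_continuousC; have [v dv] := dG z; have [] := dv l.
  - by move=> z _; have [v dv] := dG z; have [] := dv l.
  move=> z zB; have d1i : 0 < d1^-1 by rewrite invr_gt0.
  have d2i : 0 < d2^-1 by rewrite invr_gt0.
  have z0 : z != 0 by rewrite -normc_gt0; lra.
  have nz : 0 < normc z by rewrite normc_gt0.
  have z1 : normc (z^-1 - 0) < d1.
    by rewrite subr0 normcV invf_plt ?posrE //; lra.
  have z2 : normc (z^-1 - 0) < d2.
    by rewrite subr0 normcV invf_plt ?posrE //; lra.
  have E : l (G z) = z ^+ 5 * l (K z^-1).
    rewrite -(d2P _ z2) ?invr_eq0 // linearZ invrK /GRing.scale /= mulrA -exprMn.
    by rewrite mulfV // expr1n mul1r.
  have KB : normc (l (K z^-1)) <= normc (l (K 0)) + 1.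
    have := d1P _ z1; have := le_normcD (l (K z^-1) - l (K 0)) (l (K 0)).
    by rewrite subrK; lra.
  have nX : normc (z ^+ 5) = normc z ^+ 5.
    by elim: (5)%N => [|n IH]; rewrite ?normc1 // !exprS normcM IH.
  by rewrite E normcM nX mulrAC -exprSr mulrC ler_wpM2r // exprn_ge0 ?normc_ge0.
pose e := vbasis {:W}.
pose l_ i : 'Hom(W, R[i]^o) := linfun (coord e i : W -> R[i]^o).
have {}poly_lG i : exists p : {poly R[i]},
    (size p <= 6)%N /\ forall z, coord e i (G z) = p.[z].
  by have [p sp pP] := poly_lG (l_ i); exists p; split=> // z; rewrite -pP lfunE.
have /choice[p pP] := poly_lG.
pose c j := \sum_i (p i)`_j *: e`_i.
have Gc z : G z = vpoly c z.
  rewrite /vpoly /c; under eq_bigr do rewrite scaler_sumr.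
  rewrite exchange_big [LHS](coord_vbasis (memvf _)); apply: eq_bigr => i _.
  have [sp ->] := pP i; rewrite (horner_coef_wide _ sp) scaler_suml.
  by apply: eq_bigr => j _; rewrite scalerA mulrC.
exists c => //.
suff lKc (l : 'Hom(W, R[i]^o)) : l (K 0) = l (c 5%N).
  rewrite [LHS](coord_vbasis (memvf _)) [RHS](coord_vbasis (memvf _)).
  by apply: eq_bigr => i _; have := lKc (l_ i); rewrite !lfunE /= => ->.
(* The reversed polynomial t^5 l(G(1/t)): it equals l(K) for small t other than 0, hence by
   continuity at 0. *)
pose q : {poly R[i]} := \sum_(j < 6) l (c j) *: 'X^(5 - j).
have q0 : q.[0] = l (c 5%N).
  rewrite /q horner_sum big_ord_recr /= big1 ?add0r; last first.
    by move=> j _; rewrite hornerZ hornerXn expr0n subn_eq0 leqNgt ltn_ord mulr0.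
  by rewrite hornerZ hornerXn mulr1.
rewrite -q0; apply/eqP; rewrite -subr_eq0; apply/negPn/negP.
have cu : {for (0 : C), continuous (fun t : C => l (K t) - q.[t] : C)}.
  apply: continuousB; first exact: cK.
  by apply: derivable_continuousC; have [] := is_derive_hornerC q 0.
move=> /(near_neq0 cu) un0.
have /near_normcP[d d0 dP] : \forall t \near (0 : C),
    l (K t) - q.[t] != 0 /\ (t != 0 -> t ^+ 5 *: G t^-1 = K t) by exact: filterI un0 GK.
pose t : C := (d / 2)%:C.
have nt : normc t = d / 2.
  by rewrite /= expr0n addr0 sqrtr_sqr ger0_norm ?divr_ge0 ?(ltW d0).
have t0 : t != 0 by rewrite -normc_gt0 nt divr_gt0.
have [|tn /(_ t0) tK] := dP t; first by rewrite subr0 nt; lra.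
move: tn; rewrite -tK linearZ Gc; apply/negP/negPn; rewrite subr_eq0; apply/eqP.
transitivity (t ^+ 5 * l (vpoly c t^-1) : R[i]) => //.
rewrite lfun_vpoly /q !horner_sum mulr_sumr; apply: eq_bigr => j _.
rewrite !hornerZ !hornerXn.
have -> : t ^+ 5 = t ^+ (5 - j) * t ^+ j by rewrite -exprD subnK // -ltnS.
by rewrite exprVn mulrCA mulfK ?expf_neq0.
Qed.

End polynomial_lift.

(** The exponent 5 at infinity is the number of finite zeros of l plus its multiplicity at infinity,
    which is the degree. The coefficient [c 5] is the value at infinity of a nonvanishing lift. *)
Lemma curve_polynomial (R : realType) (W : vectType R[i]) (g : curve W) :
  has_degree g 5 -> exists c : nat -> W,
    [/\ forall z : Cplx R, vpoly c z != 0 /\ val (g (chart ord0 z)) = <[vpoly c z]>%VS,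
        c 5 != 0 & val (g (chart ord_max (0%R : Cplx R))) = <[c 5]>%VS].
Proof.
move=> [l [D [_ mD sD]]]; have [s cs ss] := affine_part D.
have [G GP] : exists G : Cplx R -> W, forall t,
    [/\ G t != 0, val (g (chart ord0 t)) = <[G t]>%VS,
        l (G t) = root_prod s t & exists v, has_deriv G t v].
  apply: (@global_lift _ _ (g \o @chart R ord0)) => z.
  have [G0 G0f] := curve_holomorphic g ord0 z.
  apply: (local_lift_normalize G0f); rewrite cs.
  exact: (mD _ ord0 z G0 erefl G0f).
have [H Hf] := curve_holomorphic g ord_max (0 : Cplx R).
have Hm := mD _ ord_max (0 : Cplx R) H erefl Hf.
have [||K [K0 gK cK GK]] := @lift_at_infty _ _ (g \o @chart R ord0)
  (g \o @chart R ord_max) l s _ G H _ _ Hf Hm.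
- by move=> z z0; rewrite /= chart_inv.
- by move=> z; have [_ ? ? _] := GP z.
rewrite ss sD in GK.
have [|c Gc Kc] := polynomial_lift _ cK GK; first by move=> z; have [] := GP z.
exists c; rewrite -Kc; split => // z.
by rewrite -Gc; have [] := GP z.
Qed.

Theorem corollary2 (R : realType) (W : vectType R[i])
    (form : {symmetric W}) (dimW : \dim {:W} = 5%N)
    (form_nondeg : nondegenerate form) :
  ~ exists g : curve W, [/\ null_curve form g, nonlinear g & has_degree g 5].
Proof.
move=> [g [[_ null_g] nonlin_g /curve_polynomial[c [cP c5 gc5]]]].
have null z : form (vpoly c z) (vpoly c z) = 0 /\
    form (vpoly_deriv c z) (vpoly_deriv c z) = 0.
  have lift_c : local_lift (g \o @chart R ord0) z (vpoly c).
    apply/near_normcP; exists 1 => // t _; have [? ?] := cP t; split => //.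
    by exists (vpoly_deriv c t); exact: has_deriv_vpoly.
  by have [] := null_g ord0 z _ _ lift_c (has_deriv_vpoly c z).
have iso : forall i j, (i < 6)%N -> (j < 6)%N -> form (c i) (c j) = 0.
  by apply: null_isotropic => // z; have [] := null z; have [] := cP z.
pose V := <<[tuple c i | i < 6]>>%VS.
have cV i : (i < 6)%N -> c i \in V.
  by move=> i6; apply/memv_span/mapP; exists (Ordinal i6); rewrite ?mem_enum.
(* An isotropic subspace of a space of dimension 5 satisfies 2 dim V <= 5. *)
have dV : (\dim V <= 2)%N.
  have /isotropic_dim -/(_ form_nondeg) : {in V &, forall u v, form u v = 0}.
    apply/orthovP; rewrite -orthogonalE; apply/orthogonalP.
    by move=> _ _ /mapP[i _ ->] /mapP[j _ ->]; exact: iso.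
  by rewrite dimW; lia.
have [|L L2 VL] := @subspace_extend _ _ V 2; first by rewrite dV dimW.
apply: nonlin_g; exists L; split => // p; apply: subv_trans VL.
case: (P1_cases p) => [->|[z ->]]; first by rewrite gc5 -memvE cV.
by rewrite (cP z).2 -memvE memv_suml // => i _; rewrite memvZ // cV.
Qed.
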